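(* There exists an absolute constant $\beta>0$ such that for every $0<c<1$ there is $\varepsilon_0=\varepsilon_0(c)>0$ such that for every $0<\varepsilon\le\varepsilon_0$ there is a constant $\gamma=\gamma(\varepsilon,c)>0$ for which the following holds. Let $d,n\in\mathbb{N}$ be positive integers such that $\frac{cn}{d}$ is a positive integer, let $p=\frac{1+\varepsilon}{d}$ with $p\le1$, and let $G$ be a graph on $n$ vertices such that every $S\subseteq V(G)$ with $|S|=\frac{cn}{d}$ satisfies $|N(S)|\ge d|S|$. Then the random subgraph $G_p$ contains a cycle of order at least $\beta\varepsilon^2c^2n$ with probability at least $1-\exp(-\gamma n)$.
   Context: Graphs are finite and simple. For a graph $G$ and $S\subseteq V(G)$, $N(S)=\{v\in V(G)\setminus S:\exists u\in S,\ \{u,v\}\in E(G)\}$ is the external neighbourhood of $S$ in $G$. For $p\in[0,1]$, $G_p$ denotes the random subgraph of $G$ on vertex set $V(G)$ obtained by retaining each edge of $G$ independently with probability $p$. The order of a cycle is its number of vertices (equal to its length). *)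

(* Defs.v *)
From mathcomp Require Import all_boot all_order all_algebra.
From mathcomp Require Import boolp reals.

Set Implicit Arguments.
Unset Strict Implicit.
Unset Printing Implicit Defensive.

Import Order.TTheory GRing.Theory Num.Theory.
Local Open Scope ring_scope.

(* A finite simple graph on the vertex set T is given by its set E of edges,
   which are 2-subsets of T. *)
Definition simple_graph (T : finType) (E : {set {set T}}) : bool :=
  [forall e in E, #|e| == 2].

Definition adj (T : finType) (E : {set {set T}}) : rel T :=
  fun u v => [set u; v] \in E.

Definition ext_nbhd (T : finType) (E : {set {set T}}) (S : {set T}) : {set T} :=
  [set v | (v \notin S) && [exists u in S, adj E u v]].

(* ucycle also accepts [::] and the sequence [:: u; v] of the two ends of an
   edge; the bound on the size excludes them. *)
Definition is_graph_cycle (T : finType) (E : {set {set T}}) (s : seq T) : Prop :=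
  (2 < size s)%N /\ ucycle (adj E) s.

(* The probability that the random subgraph with vertex set T and random edge
   set F \subset E satisfies A, where each edge of E belongs to F independently
   with probability p. *)
Definition prob_Gp (R : realType) (T : finType) (E : {set {set T}}) (p : R)
    (A : {set {set T}} -> Prop) : R :=
  \sum_(F : {set {set T}} | (F \subset E) && `[< A F >])
    \prod_(e in E) (if e \in F then p else 1 - p).

(* Main.v *)
Require Import Defs.
From mathcomp Require Import all_boot all_order all_algebra.
From mathcomp Require Import boolp reals sequences exp.
From mathcomp Require Import zify ring lra.

Set Implicit Arguments.
Unset Strict Implicit.
Unset Printing Implicit Defensive.

Import Order.TTheory GRing.Theory Num.Theory.
Local Open Scope ring_scope.

(** Why a long cycle appears, with probability exponentially close to 1.

Everything rests on a depth-first search that queries an edge only when it needs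
it.  The numbers of edges found and missed form a random walk, whose tails are
controlled by a supermartingale, whatever the adaptive strategy
([adaptive_tail]).  If the longest path stays short, then the search finds at
most about one edge per abandoned vertex, although it queries the whole boundary
of the abandoned set; so a boundary large enough to make this unlikely yields a
long path ([dfs_tail], [dfs_exp]).  Here k = c n / d is the size of the sets that
are assumed to expand, and each of them sees at least c n vertices.

If k >= 2, the density 1 / d is already supercritical, by a margin that depends
on c but not on eps.  For bounded d this is because the k abandoned vertices were
themselves reached through edges ([paths_small_d]).  For large d it is because
the neighbourhoods of different k-subsets of a set of linear size must overlap,
so that this set has more boundary edges than the hypothesis says directly
([cut_gain], [paths_large_d]).  Now eps0 may be chosen small with respect to c,
so the cycle to be found has length at most tau n, where tau is as small as we
like in terms of c.  A graph without cycles of length tau n has a set X of few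
vertices that meets all paths of some linear length ([separator]).  The
probability of this for one fixed X is exponentially small, and it is so by a
rate that beats the number of possible sets X ([robust_path_cycle],
[long_cycle_large_k]).

If k = 1, then G has minimum degree at least d = c n.  A disjoint union of
cliques shows that only eps makes G_p supercritical, and that paths of length of
order eps^2 d are the truth.  Such a path is found at density (1 + eps / 2) / d
([min_degree_path]).  The remaining edges are sprinkled: since each vertex of the
path has about c n neighbours outside it, linearly many outside vertices have
many neighbours in two distant segments of the path, and one of them closes a
cycle ([min_degree_link], [long_cycle_min_degree]).  The segments have a
proportion c of the path, which is where c^2 comes from.

Finally, if n is bounded in terms of c and eps, then any cycle is long enough and
gamma may be taken tiny.  So it suffices that G contains a cycle, which holds
because a forest has k vertices with at most k outer neighbours
([expanding_has_cycle], [small_graphs]). *)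

(** * Random subsets *)

Section RandomSubset.
Variables (R : realType) (X : finType).
Implicit Types (E F : {set X}) (p : R) (f g : {set X} -> R).

Lemma set_ind (P : {set X} -> Prop) :
  P set0 -> (forall e E, e \notin E -> P E -> P (e |: E)) -> forall E, P E.
Proof.
move=> P0 PS E; have [m] := ubnP #|E|; elim: m E => // m IH E ltE.
have [->//|/set0Pn[e eE]] := eqVneq E set0.
rewrite -(setD1K eE); apply: PS; first by rewrite !inE eqxx.
by apply: IH; move: ltE; rewrite (cardsD1 e) eE.
Qed.

Definition subset_weight E p F : R := \prod_(e in E) (if e \in F then p else 1 - p).

Definition expect E p f : R := \sum_(F : {set X} | F \subset E) subset_weight E p F * f F.

Lemma expect0 p f : expect set0 p f = f set0.
Proof.
rewrite /expect (big_pred1 set0) => [|F]; last by rewrite subset0.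
by rewrite /subset_weight big_set0 mul1r.
Qed.

Lemma expectU1 e E p f : e \notin E ->
  expect (e |: E) p f =
    p * expect E p (fun F => f (e |: F)) + (1 - p) * expect E p f.
Proof.
move=> eE; rewrite /expect (bigID (fun F : {set X} => e \in F)) /=; congr (_ + _).
  rewrite (reindex_onto (fun F : {set X} => e |: F) (fun F => F :\ e)) /=; last first.
    by move=> F /andP[_ eF]; rewrite setD1K.
  rewrite mulr_sumr; apply: eq_big => [F|F sF].
    rewrite setU11 andbT subUset sub1set setU11 /=; apply/andP/idP.
      case=> /subsetP sF /eqP <-; apply/subsetP => x; rewrite !inE => /andP[xe].
      by rewrite (negPf xe) /= => /sF; rewrite !inE (negPf xe).
    move=> sF; split; first by apply: subset_trans sF (subsetU1 _ _).
    by apply/eqP/setU1K; apply: contra eE; apply: (subsetP sF).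
  rewrite mulrA; congr (_ * _).
  rewrite /subset_weight big_setU1 //= setU11; congr (_ * _); apply: eq_bigr => x xE.
  by rewrite !inE; case: eqP => // xe; rewrite -xe xE in eE.
rewrite mulr_sumr; apply: eq_big => [F|F /andP[_ eF]].
  apply/andP/idP; last first.
    move=> sF; split; first by apply: subset_trans sF (subsetU1 _ _).
    by apply: contra eE; apply: (subsetP sF).
  case=> /subsetP sF eF; apply/subsetP => x xF.
  by have := sF x xF; rewrite !inE => /orP[/eqP xe|//]; rewrite -xe xF in eF.
by rewrite mulrA; congr (_ * _); rewrite /subset_weight big_setU1 //= (negPf eF).
Qed.

Lemma expect_cst E p a : expect E p (fun=> a) = a.
Proof.
elim/set_ind: E => [|e E eE IH]; first exact: expect0.
by rewrite expectU1 // IH; ring.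
Qed.

Lemma eq_expect E p f g : (forall F, F \subset E -> f F = g F) ->
  expect E p f = expect E p g.
Proof. by move=> fg; apply: eq_bigr => F /fg ->. Qed.

Lemma expectD E p f g :
  expect E p (fun F => f F + g F) = expect E p f + expect E p g.
Proof. by rewrite -big_split; apply: eq_bigr => F _; rewrite mulrDr. Qed.

Lemma expectZ E p a f : expect E p (fun F => a * f F) = a * expect E p f.
Proof. by rewrite mulr_sumr; apply: eq_bigr => F _; ring. Qed.

Lemma expect_sum (I : finType) (P : pred I) E p (f : I -> {set X} -> R) :
  expect E p (fun F => \sum_(i | P i) f i F) = \sum_(i | P i) expect E p (f i).
Proof. by rewrite exchange_big; apply: eq_bigr => F _; rewrite mulr_sumr. Qed.

Lemma subset_weight_ge0 E p F : 0 <= p <= 1 -> 0 <= subset_weight E p F.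
Proof. by case/andP=> p0 p1; apply: prodr_ge0 => e _; case: ifP; rewrite ?subr_ge0. Qed.

Lemma le_expect E p f g : 0 <= p <= 1 ->
  (forall F, F \subset E -> f F <= g F) -> expect E p f <= expect E p g.
Proof.
by move=> p01 fg; apply: ler_sum => F /fg; apply: ler_wpM2l; apply: subset_weight_ge0.
Qed.

Lemma expect_ge0 E p f : 0 <= p <= 1 ->
  (forall F, F \subset E -> 0 <= f F) -> 0 <= expect E p f.
Proof.
by move=> p01 f0; rewrite -(expect_cst E p 0); apply: le_expect.
Qed.

Lemma expect_split E1 E2 p f : [disjoint E1 & E2] ->
  expect (E1 :|: E2) p f =
    expect E1 p (fun F1 => expect E2 p (fun F2 => f (F1 :|: F2))).
Proof.
elim/set_ind: E1 f => [|e E1 eE1 IH] f.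
  by move=> _; rewrite set0U expect0; apply: eq_expect => F _; rewrite set0U.
rewrite -!setI_eq0 setIUl setU_eq0 !setI_eq0 disjoints1 => /andP[eE2 dE].
rewrite -setUA expectU1 ?inE ?negb_or ?eE1 // !IH // expectU1 //.
by congr (_ * _ + _); do 2!apply: eq_expect => ? _; rewrite setUA.
Qed.

(** Sprinkling: keeping an element when at least one of two independent
coins of biases p1 and p2 succeeds. *)
Lemma expect_sprinkle E p p1 p2 f : 1 - p = (1 - p1) * (1 - p2) ->
  expect E p f = expect E p1 (fun F1 => expect E p2 (fun F2 => f (F1 :|: F2))).
Proof.
move=> pE; elim/set_ind: E f => [|e E eE IH] f; first by rewrite !expect0 setU0.
rewrite !expectU1 // !IH.
under [X in _ = _ * X + _]eq_expect => F1 _.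
  rewrite expectU1 //.
  under eq_expect do rewrite setUCA -setUA setUA setUid.
  under [X in _ + _ * X]eq_expect do rewrite -setUA.
  rewrite -mulrDl addrC subrK mul1r.
  over.
under [X in _ = _ + _ * X]eq_expect => F1 _.
  rewrite expectU1 //.
  under eq_expect do rewrite setUCA.
  over.
rewrite expectD !expectZ.
set a := expect E p1 _; set b := expect E p1 _.
have -> : p = 1 - (1 - p1) * (1 - p2) by rewrite -pE; ring.
ring.
Qed.

Lemma expect_indep E1 E2 p f g : [disjoint E1 & E2] ->
  expect (E1 :|: E2) p (fun F => f (F :&: E1) * g (F :&: E2)) =
  expect E1 p f * expect E2 p g.
Proof.
move=> dE; rewrite expect_split // mulrC -expectZ; apply: eq_expect => F1 sF1.
rewrite mulrC -expectZ; apply: eq_expect => F2 sF2; congr (f _ * g _).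
  rewrite setIUl (setIidPl sF1) (_ : F2 :&: E1 = set0) ?setU0 //.
  by apply/eqP; rewrite setI_eq0 disjoint_sym; apply: disjointWr sF2 dE.
rewrite setIUl (setIidPl sF2) (_ : F1 :&: E2 = set0) ?set0U //.
by apply/eqP; rewrite setI_eq0; apply: disjointWl sF1 dE.
Qed.

Lemma expect_empty E p : expect E p (fun F => (F == set0)%:R) = (1 - p) ^+ #|E|.
Proof.
elim/set_ind: E => [|e E eE IH]; first by rewrite expect0 eqxx cards0.
rewrite expectU1 // IH cardsU1 eE exprS (@eq_expect _ _ _ (fun=> 0)) => [|F _].
  by rewrite expect_cst mulr0 add0r.
by rewrite (_ : e |: F == set0 = false) //; apply/negP => /eqP/setP/(_ e); rewrite !inE eqxx.
Qed.

Definition Pr E p (A : {set X} -> Prop) : R := expect E p (fun F => `[< A F >]%:R).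

Lemma PrC E p A : Pr E p A = 1 - Pr E p (fun F => ~ A F).
Proof.
apply/eqP; rewrite -subr_eq0 opprB addrA subr_eq0 -expectD; apply/eqP.
rewrite -[RHS](expect_cst E p); apply: eq_expect => F _; rewrite asbool_neg.
by case: asbool; rewrite ?addr0 ?add0r.
Qed.

Lemma le_Pr E p (A B : {set X} -> Prop) : 0 <= p <= 1 ->
  (forall F, F \subset E -> A F -> B F) -> Pr E p A <= Pr E p B.
Proof.
move=> p01 AB; apply: le_expect => // F sF; rewrite ler_nat.
by case: (asboolP (A F)) => // /(AB _ sF) ?; rewrite asboolT.
Qed.

Lemma Pr_union (I : finType) (P : pred I) E p (A : {set X} -> Prop)
    (B : I -> {set X} -> Prop) : 0 <= p <= 1 ->
  (forall F, F \subset E -> A F -> exists2 i, P i & B i F) ->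
  Pr E p A <= \sum_(i | P i) Pr E p (B i).
Proof.
move=> p01 AB; rewrite -expect_sum; apply: le_expect => // F sF.
have B0 i : P i -> 0 <= `[< B i F >]%:R :> R by rewrite ler0n.
case: (asboolP (A F)) => [/(AB _ sF)[i Pi Bi]|_]; last exact: sumr_ge0.
by rewrite (bigD1 i) //= (asboolT Bi) lerDl; apply: sumr_ge0 => j /andP[/B0].
Qed.

(** A crude bound, good enough when the number of elements is bounded. *)
Lemma Pr_full E p (A : {set X} -> Prop) : 0 <= p <= 1 -> A E -> p ^+ #|E| <= Pr E p A.
Proof.
move=> p01 AE; rewrite /Pr /expect (bigD1 E) //= (asboolT AE) mulr1.
rewrite (_ : subset_weight E p E = p ^+ #|E|); last first.
  by rewrite -prodr_const; apply: eq_bigr => e ->.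
by rewrite lerDl; apply: sumr_ge0 => F _; rewrite mulr_ge0 ?subset_weight_ge0 ?ler0n.
Qed.

(** With p x + (1 - p) y <= 1, the product x ^ successes y ^ failures is a
supermartingale along any sequence of distinct tosses, even an adaptive one.  The
strategy is described by the states (K, F0) that it can reach, where K is the set
of tosses made and F0 the set of successes. *)
Lemma adaptive_tail E p (x y : R) (P0 N0 : nat) (A : {set X} -> Prop)
    (Inv : {set X} -> {set X} -> Prop) :
  0 <= p <= 1 -> 0 < x -> x <= 1 -> 1 <= y -> p * x + (1 - p) * y <= 1 ->
  (forall K F0 : {set X}, F0 \subset K -> K \subset E -> Inv K F0 ->
    (exists2 e, e \in E :\: K & Inv (e |: K) (e |: F0) /\ Inv (e |: K) F0) \/
    (forall F, F \subset E -> F :&: K = F0 -> A F ->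
       (#|F0| <= P0 /\ N0 <= #|K :\: F0|)%N)) ->
  Inv set0 set0 -> Pr E p A <= x ^- P0 * y ^- N0.
Proof.
move=> p01 x0 x1 y1 xy step Inv0.
have y0 : 0 < y by apply: lt_le_trans y1.
pose B := x ^- P0 * y ^- N0.
have B0 : 0 < B by rewrite mulr_gt0 // invr_gt0 exprn_gt0.
suff main (K F0 : {set X}) : F0 \subset K -> K \subset E -> Inv K F0 ->
    Pr (E :\: K) p (fun F => A (F0 :|: F)) <= B * (x ^+ #|F0| * y ^+ #|K :\: F0|).
  have := main set0 set0 (sub0set _) (sub0set _) Inv0.
  rewrite !setD0 cards0 !expr0 !mulr1; congr (_ <= _).
  by apply: eq_expect => F _; rewrite set0U.
have [m] := ubnP #|E :\: K|; elim: m K F0 => // m IH K F0 ltm sF0 sK inv.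
case: (step K F0 sF0 sK inv) => [[e eEK [inv1 inv2]]|stop].
  have eK : e \notin K by move: eEK; rewrite inE => /andP[].
  have eF0 : e \notin F0 by apply: contra eK; apply: (subsetP sF0).
  have EK : E :\: K = e |: (E :\: (e |: K)).
    by rewrite [e |: K]setUC -setDDl setD1K.
  have sK' : e |: K \subset E by rewrite subUset sub1set sK (subsetP (subsetDl E K)).
  have ltm' : (#|E :\: (e |: K)| < m)%N.
    by move: ltm; rewrite EK cardsU1 !inE eqxx.
  have := IH _ _ ltm' (setUS _ sF0) sK' inv1.
  have := IH _ _ ltm' (subset_trans sF0 (subsetU1 _ _)) sK' inv2.
  have -> : (e |: K) :\: (e |: F0) = K :\: F0.
    apply/setP => z; rewrite !inE; case: eqP => //= ->; by rewrite (negPf eK) andbF.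
  have -> : (e |: K) :\: F0 = e |: (K :\: F0).
    by apply/setP => z; rewrite !inE; case: eqP => //= ->; rewrite eF0.
  rewrite !cardsU1 eF0 inE negb_and eK orbT /= !add1n !exprS => H2 H1.
  rewrite /Pr EK expectU1 ?inE ?eqxx //.
  have {1}-> : expect (E :\: (e |: K)) p (fun F => `[< A (F0 :|: (e |: F)) >]%:R) =
      Pr (E :\: (e |: K)) p (fun F => A (e |: F0 :|: F)).
    by apply: eq_expect => F _; rewrite setUCA setUA.
  rewrite -/(Pr _ p (fun F => A (F0 :|: F))).
  have /andP[p0 p1] := p01.
  apply: (le_trans (lerD (ler_wpM2l p0 H1) (ler_wpM2l _ H2))); first by rewrite subr_ge0.
  set b := x ^+ _; set c := y ^+ _.
  have bc0 : 0 <= B * (b * c) 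
    by apply: mulr_ge0 (ltW B0) _; apply: mulr_ge0; apply/exprn_ge0/ltW.
  have := ler_wpM2r bc0 xy; rewrite mul1r; congr (_ <= _); ring.
case: (EM (exists2 F : {set X}, F \subset E :\: K & A (F0 :|: F))) => [[F1 sF1 AF1]|nA].
  have [le1 le2] : (#|F0| <= P0 /\ N0 <= #|K :\: F0|)%N.
    apply: (stop (F0 :|: F1)) => //.
      by rewrite subUset (subset_trans sF0 sK) (subset_trans sF1 (subsetDl _ _)).
    rewrite setIUl (setIidPl sF0) (_ : F1 :&: K = set0) ?setU0 //.
    apply/setP => z; rewrite !inE; apply/negP => /andP[/(subsetP sF1)].
    by rewrite inE => /andP[/negP].
  have -> : B * (x ^+ #|F0| * y ^+ #|K :\: F0|) =
     (x ^+ #|F0| / x ^+ P0) * (y ^+ #|K :\: F0| / y ^+ N0) by rewrite /B; ring.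
  apply: (@le_trans _ _ 1).
    rewrite -[leRHS](expect_cst (E :\: K) p); apply: le_expect => // F _.
    by rewrite lern1 leq_b1.
  rewrite -[1]mulr1; apply: ler_pM => //.
    by rewrite ler_pdivlMr ?exprn_gt0 // mul1r ler_wiXn2l // ltW.
  by rewrite ler_pdivlMr ?exprn_gt0 // mul1r ler_weXn2l.
rewrite /Pr (@eq_expect _ _ _ (fun=> 0)) => [|F sF]; last first.
  by rewrite asboolF // => AF; apply: nA; exists F.
by rewrite expect_cst; apply: mulr_ge0 (ltW B0) _; apply: mulr_ge0; apply/exprn_ge0/ltW.
Qed.

End RandomSubset.

(** * Depth-first search in a percolated graph *)

Section Dfs.
Variables (R : realType) (T : finType).
Implicit Types (S U W X : {set T}) (u : seq T).

Lemma adjC (E : {set {set T}}) (u v : T) : adj E u v = adj E v u.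
Proof. by rewrite /adj setUC. Qed.

Lemma adj_sub (F F' : {set {set T}}) : F \subset F' -> subrel (adj F) (adj F').
Proof. by move=> /subsetP sF u v /sF. Qed.

Definition has_path (F : {set {set T}}) X m :=
  exists u, [/\ uniq u, sorted (adj F) u, {in u, forall v, v \notin X} & (m <= size u)%N].

Definition cut_size (E : {set {set T}}) S W := (\sum_(w in W) #|[set s in S | adj E s w]|)%N.

(** Pairs (s, w) with s in S and w in W are counted by cut_size; as S and W are
disjoint, different pairs are different edges. *)
Lemma cut_size_le (E D : {set {set T}}) S W : [disjoint S & W] ->
  (forall s w, s \in S -> w \in W -> adj E s w -> [set s; w] \in D) ->
  (cut_size E S W <= #|D|)%N.
Proof.
move=> dSW inD; pose P := [set q : T * T | [&& q.2 \in W, q.1 \in S & adj E q.1 q.2]].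
have -> : cut_size E S W = #|P|.
  rewrite -sum1_card (eq_bigl (fun q : T * T => (q.2 \in W) && ((q.1 \in S) && adj E q.1 q.2))).
    rewrite /cut_size (eq_bigr (fun w => \sum_(s | (s \in S) && adj E s w) 1)%N) => [|w _].
      rewrite (pair_big_dep (fun w => w \in W) (fun w s => (s \in S) && adj E s w)) /=.
      rewrite (reindex (fun q : T * T => (q.2, q.1))) //=.
      by exists (fun q : T * T => (q.2, q.1)) => -[].
    by rewrite -sum1_card; apply: eq_bigl => s; rewrite !inE.
  by move=> q; rewrite inE.
have inj : {in P &, injective (fun q : T * T => [set q.1; q.2])}.
  move=> [s w] [s' w']; rewrite !inE /= => /and3P[wW sS _] /and3P[wW' sS' _] eqs.
  have ne a b : a \in S -> b \in W -> a != b.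
    by move=> aS bW; apply: contraTneq bW => <-; rewrite (disjointFr dSW).
  have : s \in [set s'; w'] by rewrite -eqs !inE eqxx.
  have : w \in [set s'; w'] by rewrite -eqs !inE eqxx orbT.
  rewrite !inE (negPf (ne _ _ sS wW')) orbF eq_sym (negPf (ne _ _ sS' wW)) /=.
  by move=> /eqP -> /eqP ->.
rewrite -(card_in_imset inj); apply/subset_leq_card/subsetP => f /imsetP[[s w]].
by rewrite inE /= => /and3P[wW sS a] ->; apply: inD.
Qed.

(** The state of a search outside X: the edges of K have been queried and those
of F0 found, the vertices of S have been abandoned after all their edges to
unvisited vertices were queried in vain, and u is the current path, top first. *)
Definition dfs_state (E : {set {set T}}) X s0 (K F0 : {set {set T}}) S u : Prop :=
  [/\ [/\ uniq u, sorted (adj F0) u & {in u, forall v, (v \notin X) && (v \notin S)}],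
      [disjoint S & X] /\ (#|S| <= s0)%N,
      (#|F0| <= #|S| + size u)%N,
      (forall s w, s \in S -> w \notin S -> w \notin u -> w \notin X ->
         adj E s w -> [set s; w] \in K :\: F0) &
      (forall f z, f \in F0 -> z \in f -> (z \in S) || (z \in u))].

(** A search whose path is short and which has abandoned fewer than s0 vertices
either has an edge to query next or can move on without a query: start a new
path, or abandon the top of its path.  Such moves increase 2 #|S| + size u, so
that a query or a stop is reached. *)
Lemma dfs_step (E : {set {set T}}) X s0 l0 (K F0 : {set {set T}}) S u :
  (s0 + l0 + #|X| < #|T|)%N -> F0 \subset K -> K \subset E ->
  dfs_state E X s0 K F0 S u ->
  (exists2 e, e \in E :\: K &
     (exists S' u', dfs_state E X s0 (e |: K) (e |: F0) S' u') /\
     (exists S' u', dfs_state E X s0 (e |: K) F0 S' u')) \/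
  (exists S' u', dfs_state E X s0 K F0 S' u' /\ ((l0 < size u')%N \/ #|S'| = s0)).
Proof.
move=> big sF0 sK; have [m] := ubnP (3 * #|T| - (2 * #|S| + size u)).
elim: m S u => // m IH S u ltm st.
have measure a b a' b' : (3 * #|T| - (2 * a + b) < m.+1 -> 2 * a + b < 2 * a' + b' ->
    a < #|T| -> b <= #|T| -> 3 * #|T| - (2 * a' + b') < m)%N.
  by clear; lia.
have [ltu|leu] := ltnP l0 (size u); first by right; exists S, u; split=> //; left.
have [eS|neS] := eqVneq #|S| s0; first by right; exists S, u; split=> //; right.
have [[uu su uXS] [dSX leS] leF cutS inF] := st.
have ltS : (#|S| < s0)%N by rewrite ltn_neqAle neS.
have ltST : (#|S| < #|T|)%N.
  by apply: (ltn_trans ltS); apply: leq_ltn_trans big; rewrite -addnA leq_addr.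
have cardu : (size u <= #|T|)%N by rewrite -(card_uniqP uu) max_card.
case: u => [|x u'] in ltm leu st uu su uXS leF cutS inF cardu *.
  have [w] : exists w, w \notin S :|: X.
    have : (#|S :|: X| < #|T|)%N by rewrite cardsU; clear - big ltS; lia.
    have := cardsC (S :|: X).
    case: (set_0Vmem (~: (S :|: X))) => [->|[w]]; first by rewrite cards0; clear - big ltS; lia.
    by rewrite inE; exists w.
  rewrite inE negb_or => /andP[wS wX]; apply: (IH S [:: w]).
    by apply: (measure _ _ _ _ ltm); rewrite //= addn0 addn1.
  split=> //.
  - by split=> // v; rewrite inE => /eqP ->; rewrite wX wS.
  - by move: leF; clear => /=; lia.
  - by move=> s z sS zS _; apply: cutS.
  - by move=> f z fF0 zf; have := inF f z fF0 zf; rewrite orbF => ->.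
have /andP[xX xS] := uXS x (mem_head _ _).
pose fresh w := [&& w \notin S, w \notin x :: u', w \notin X & [set x; w] \in E :\: K].
have [/existsP[w /and4P[wS wu wX wE]]|none] := boolP [exists w, fresh w].
  left; exists [set x; w] => //; split; last first.
    exists S, (x :: u'); split=> // s z sS zS zu zX a.
    by have := cutS s z sS zS zu zX a; rewrite !inE => /andP[-> ->]; rewrite orbT.
  have wF : [set x; w] \notin F0.
    by move: wE; rewrite inE => /andP[/negP wK _]; apply/negP => /(subsetP sF0).
  exists S, (w :: x :: u'); split=> //.
  - split.
    + by rewrite cons_uniq wu.
    + rewrite [sorted _ _]/= {1}/adj setUC setU11 /=.
      by apply: sub_sorted su; apply: adj_sub; apply: subsetU1.
    + by move=> v; rewrite inE => /orP[/eqP ->|/uXS //]; rewrite wX wS.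
  - by rewrite cardsU1 wF; move: leF; clear => /=; lia.
  - move=> s z sS zS; rewrite inE negb_or => /andP[zw zu] zX a.
    have := cutS s z sS zS zu zX a; rewrite !inE negb_or => /andP[-> ->]; rewrite orbT !andbT.
    apply/eqP => eqs; have : w \in [set s; z] by rewrite eqs !inE eqxx orbT.
    by rewrite !inE [w == z]eq_sym (negPf zw) orbF => /eqP ws; rewrite ws sS in wS.
  - move=> f z; rewrite inE => /orP[|fF0 zf].
      by rewrite inE => /eqP ->; rewrite !inE => /orP[/eqP ->|/eqP ->]; rewrite eqxx ?orbT.
    by have /orP[->//|zu] := inF f z fF0 zf; rewrite inE zu !orbT.
have memu z : z \notin x |: S -> z \notin u' -> (z \notin S) && (z \notin x :: u').
  by rewrite !inE !negb_or => /andP[-> ->] ->.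
apply: (IH (x |: S) u').
  by apply: (measure _ _ _ _ ltm); rewrite // cardsU1 xS /= mulnDr addnS addnAC addnC.
split=> //.
- split; first by move: uu => /andP[].
    by apply: path_sorted su.
  move=> v vu; have := uXS v; rewrite in_cons vu orbT => /(_ isT) /andP[-> vS].
  rewrite !inE negb_or vS andbT /=; apply: contraTneq vu => ->.
  by move: uu => /andP[].
- by rewrite -setI_eq0 setIUl setU_eq0 !setI_eq0 disjoints1 xX cardsU1 xS.
- by move: leF; rewrite cardsU1 xS /=; clear; lia.
- move=> s z /setU1P[->|sS] zxS zu zX a.
    have /andP[zS zxu] := memu z zxS zu.
    have zF0 : [set x; z] \notin F0.
      apply/negP => /inF /(_ (set22 x z)); by rewrite (negPf zS) (negPf zxu).
    move: none; rewrite negb_exists => /forallP/(_ z); rewrite /fresh zS zxu zX /= !inE.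
    by rewrite zF0 (_ : [set x; z] \in E) // andbT negbK.
  have /andP[zS zxu] := memu z zxS zu.
  by have := cutS s z sS zS zxu zX a; rewrite !inE.
- move=> f z fF0 zf; have := inF f z fF0 zf; rewrite !inE.
  by case/or3P => ->; rewrite ?orbT.
Qed.

(** When the search has abandoned s0 vertices and its path has at most l0
vertices, at most s0 + l0 edges were found while the whole boundary of the
abandoned set was queried in vain. *)
Lemma dfs_tail (E : {set {set T}}) X s0 l0 N0 (p x y : R) :
  0 <= p <= 1 -> 0 < x -> x <= 1 -> 1 <= y -> p * x + (1 - p) * y <= 1 ->
  (s0 + l0 + #|X| < #|T|)%N ->
  (forall S U, #|S| = s0 -> (#|U| <= l0)%N -> [disjoint S & X] ->
     (N0 <= cut_size E S (~: (S :|: U :|: X)))%N) ->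
  Pr E p (fun F => ~ has_path F X l0.+1) <= x ^- (s0 + l0) * y ^- N0.
Proof.
move=> p01 x0 x1 y1 xy big cutN.
apply: (adaptive_tail (Inv := fun K F0 => exists S u, dfs_state E X s0 K F0 S u)) => //.
  move=> K F0 sF0 sK [S [u st]].
  have [//|[S' [u' [[[uu su uXS] [dSX leS] leF cutS inF] stop]]]] := dfs_step big sF0 sK st;
    first by left.
  right=> F sF FK nop.
  have sF0F : F0 \subset F by rewrite -FK subsetIl.
  have leu : (size u' <= l0)%N.
    rewrite leqNgt; apply/negP => ltu; apply: nop; exists u'; split=> //.
      by apply: sub_sorted su; apply: adj_sub.
    by move=> v /uXS /andP[].
  case: stop => [|eS]; first by rewrite ltnNge leu.
  split; first by rewrite (leq_trans leF) // eS leq_add2l.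
  have := cutN S' [set z in u'] eS; rewrite cardsE (card_uniqP uu) => /(_ leu dSX) le1.
  apply: (leq_trans le1); apply: cut_size_le.
    by rewrite disjoints_subset setCK -setUA subsetUl.
  move=> s w sS'; rewrite !inE !negb_or => /andP[/andP[wS wu] wX] a.
  by have := cutS s w sS' wS wu wX a; rewrite !inE.
exists set0, [::]; split=> //.
- by split=> //; rewrite ?cards0 // -setI_eq0 set0I.
- by rewrite !cards0.
- by move=> s w; rewrite inE.
- by move=> f z; rewrite inE.
Qed.

End Dfs.

(** * Separators of graphs without long cycles *)

Section Separator.
Variables (T : finType) (e : rel T).
Hypothesis e_sym : symmetric e.
Implicit Types (C V W X : {set T}) (P u : seq T).

Definition within W : rel T := fun x y => [&& x \in W, y \in W & e x y].

Definition connected W := {in W &, forall x y, connect (within W) x y}.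

Definition long_path W m :=
  exists u, [/\ uniq u, sorted e u, {subset u <= W} & (m <= size u)%N].

Lemma within_sym W : symmetric (within W).
Proof. by move=> x y; rewrite /within e_sym andbCA. Qed.

Lemma path_within W x q : path (within W) x q -> {subset q <= W}.
Proof.
elim: q x => //= y q IH x /andP[/and3P[_ yW _] /IH sq] z.
by rewrite inE => /orP[/eqP ->|/sq].
Qed.

Lemma sorted_within W u : {subset u <= W} -> sorted e u -> sorted (within W) u.
Proof.
case: u => //= x u sW; elim: u x sW => //= y u IH x sW /andP[exy pu].
rewrite {1}/within exy !sW ?inE ?eqxx ?orbT //=; apply: IH => // z zu.
by apply: sW; rewrite inE zu orbT.
Qed.

Definition component W x := [set y in W | connect (within W) x y].

Lemma component_connected W x : x \in W -> connected (component W x).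
Proof.
move=> xW; have fromx y : y \in component W x -> connect (within (component W x)) x y.
  rewrite inE => /andP[_ /connectP[q pq ->]].
  elim/last_ind: q pq => [|q z IH] //; rewrite rcons_path last_rcons => /andP[pq wz].
  apply: connect_trans (IH pq) (connect1 _); move: (wz) => /and3P[lW zW elz].
  have xl : connect (within W) x (last x q) by apply/connectP; exists q.
  rewrite /within !inE lW zW elz xl /= andbT.
  by apply: connect_trans xl (connect1 wz).
move=> y z yC zC; apply: connect_trans (fromx z zC).
by rewrite (sym_connect_sym (@within_sym _)); apply: fromx.
Qed.

Lemma connect_cross (r : rel T) C x y : connect r x y -> x \in C -> y \notin C ->
  exists a b, [/\ a \in C, b \notin C & r a b].
Proof.
case/connectP=> q; elim: q x => [|z q IH] x /=; first by move=> _ -> ->.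
move=> /andP[rxz pq] yE xC yC; have [zC|zC] := boolP (z \in C); first exact: IH pq yE zC yC.
by exists x, z.
Qed.

(** The cycle follows the path from z to v and returns to z inside C. *)
Lemma close_cycle C P1 z P2 v y :
  sorted e (rcons (P1 ++ z :: P2) v) -> uniq (P1 ++ z :: P2) ->
  {in P1 ++ z :: P2, forall w, w \notin C} -> connected C -> v \in C -> y \in C ->
  e y z -> exists2 s, ucycle e s & (size P2 + 2 <= size s)%N.
Proof.
move=> sP uP PC conC vC yC eyz.
have /connectP[q0 pq0 yE] := conC v y vC yC.
case: (shortenP pq0) yE => q pq uq _ yE.
have qC w : w \in v :: q -> w \in C.
  by rewrite inE => /orP[/eqP ->//|]; apply: path_within pq _.
exists (z :: P2 ++ v :: q); last by rewrite /= size_cat /=; rewrite addn2 addnS !ltnS leq_addr.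
apply/andP; split; last first.
  have /and3P[_ _ uzP] : [&& uniq P1, ~~ has (mem P1) (z :: P2) & uniq (z :: P2)].
    by rewrite -cat_uniq.
  rewrite -cat_cons cat_uniq uzP uq andbT; apply/hasPn => w /qC wC.
  by apply/negP => wP; have := PC w; rewrite mem_cat wP orbT wC => /(_ isT).
move: sP; rewrite rcons_cat => /cat_sorted2[_] /=.
rewrite rcons_path => /andP[pP ev].
rewrite rcons_cat cat_path pP /= ev rcons_path -yE eyz andbT.
by apply: sub_path pq => a b /and3P[].
Qed.

Variables (t a : nat).
Hypotheses (a_gt0 : (0 < a)%N) (no_cycle : forall s, ucycle e s -> (size s < t)%N).

(** The path P leads to the connected set C and contains all its other
neighbours.  Since a neighbour of C far from the end of P would close a long
cycle, the last vertices of P already separate C.  The path is prolonged into C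
as long as a large piece of C remains beyond it. *)
Lemma piece_from_path V C P v :
  sorted e (rcons P v) -> uniq P -> v \in C -> C \subset V ->
  {in P, forall z, z \notin C} -> connected C -> (a <= #|C|)%N ->
  (forall y z, y \in C -> z \in V -> e y z -> (z \in C) || (z \in P)) ->
  exists X0 C0, [/\ (#|X0| <= t)%N, (a <= #|C0|)%N, C0 \subset V,
    forall y z, y \in C0 :\: X0 -> z \in V :\: X0 -> e y z -> z \in C0 &
    ~ long_path (C0 :\: X0) a].
Proof.
have [m] := ubnP #|C|; elim: m C P v => // m IH C P v ltm sP uP vC CV PC conC aC nbC.
case: (EM (long_path (C :\ v) a)) => [[[|x u] [uu su uC au]]|noP].
- by move: au a_gt0; case: (a).
- pose C' := component (C :\ v) x.
  have xC : x \in C :\ v by apply: uC; rewrite mem_head.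
  have uC' : {subset x :: u <= C'}.
    move=> y yu; rewrite inE uC //=; apply: path_connect yu.
    by apply: (sorted_within uC).
  have C'C y : y \in C' -> y \in C by rewrite !inE => /andP[/andP[]].
  have vC' : v \notin C' by rewrite !inE eqxx.
  have xCC : x \in C by apply: C'C; apply: uC'; rewrite mem_head.
  have [y [z [yC' zC' /and3P[yC zC eyz]]]] :=
    connect_cross (conC x v xCC vC) (uC' x (mem_head _ _)) vC'.
  have grow w w' : w \in C' -> w' \in C -> w' != v -> e w w' -> w' \in C'.
    move=> wC' w'C w'v ew; have := wC'; rewrite inE => /andP[wC1 cw].
    rewrite inE in_setD1 w'v w'C; apply: connect_trans cw (connect1 _).
    by rewrite /within wC1 in_setD1 w'v w'C.
  have zv : z = v by apply: contraNeq zC' => zv; apply: grow zv eyz.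
  subst z.
  apply: (IH C' (rcons P v) y) => //.
  + rewrite ltnS in ltm; apply: leq_trans ltm; apply: proper_card.
    apply/properP; split; first by apply/subsetP.
    by exists v.
  + case: P {PC nbC uP} sP => [|p0 P] /=; first by rewrite e_sym eyz.
    by move=> sP; rewrite rcons_path sP last_rcons e_sym eyz.
  + by rewrite rcons_uniq uP andbT; apply/negP => /PC; rewrite vC.
  + by apply: subset_trans CV; apply/subsetP.
  + move=> w; rewrite mem_rcons inE => /orP[/eqP ->//|/PC].
    by apply: contra; apply: C'C.
  + exact: component_connected.
  + apply: leq_trans au _; rewrite -(card_uniqP uu); apply/subset_leq_card/subsetP.
    exact: uC'.
  + move=> w w' wC' w'V ew; rewrite mem_rcons inE.
    have [//|w'v] := eqVneq w' v; first by rewrite orbT.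
    have /orP[w'C|w'P] := nbC w w' (C'C _ wC') w'V ew; last by rewrite w'P !orbT.
    by rewrite (grow w w').
pose A := [set z in drop (size P - t.-1) P].
have cA : (#|A| <= t.-1)%N.
  by rewrite cardsE; apply: leq_trans (card_size _) _; rewrite size_drop; rewrite leq_subLR addnC -leq_subLR.
have t0 : (0 < t)%N by have := @no_cycle [::] isT.
have inA y z : y \in C -> z \in P -> e y z -> z \in A.
  move=> yC zP eyz; rewrite inE; case/splitPr: zP sP uP PC => P1 P2 sP uP PC.
  have [s /no_cycle lts les] := close_cycle sP uP PC conC vC yC eyz.
  have le2 : (size P2 + 2 < t)%N by apply: leq_ltn_trans les lts.
  rewrite drop_cat size_cat /=; case: ltnP => [_|le1].
    by rewrite mem_cat mem_head orbT.
  rewrite (_ : (_ - _ - _)%N = 0%N) ?drop0 ?mem_head //.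
  by apply/eqP; rewrite subnAC addKn subn_eq0 -ltnS prednK // ltnW // -addn2.
exists (v |: A), C; split=> //.
- rewrite cardsU1; apply: leq_trans (leq_add (leq_b1 _) cA) _.
  by rewrite add1n prednK.
- move=> y z; rewrite !inE negb_or => /andP[_ yC] /andP[/norP[zv zA] zV] eyz.
  have /orP[//|zP] := nbC y z yC zV eyz.
  by have := inA y z yC zP eyz; rewrite inE (negPf zA).
- case=> u [uu su uC au]; apply: noP; exists u; split=> // z /uC.
  by rewrite !inE negb_or => /andP[/andP[-> _] ->].
Qed.

Lemma sorted_stay C W u : {subset u <= W} -> sorted e u ->
  (forall y z, y \in C -> z \in W -> e y z -> z \in C) ->
  {subset u <= C} \/ {in u, forall z, z \notin C}.
Proof.
move=> uW su st; case: u uW su => [|x u] uW /= pu; first by right.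
elim: u x uW pu => [|y u IH] x uW /=.
  by case: (boolP (x \in C)) => xC; [left|right] => z; rewrite inE => /eqP ->.
move=> /andP[exy pu].
have xW : x \in W by apply: uW; rewrite mem_head.
have yW : y \in W by apply: uW; rewrite !inE eqxx orbT.
have uW' : {subset y :: u <= W} by move=> z zu; apply: uW; rewrite inE zu orbT.
case: (IH y uW' pu) => uC; [left|right] => z; rewrite inE => /orP[/eqP ->|/uC //].
  by apply: (st y) => //; rewrite 1?e_sym //; apply: uC; rewrite mem_head.
apply/negP => xC; have := uC y (mem_head _ _).
by rewrite (st x).
Qed.

(** Cutting off pieces of at least a vertices, at the cost of at most t vertices
each, until no path of a vertices is left. *)
Lemma separator V : exists2 X : {set T}, (#|X| * a <= t * #|V|)%N & ~ long_path (V :\: X) a.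
Proof.
have [m] := ubnP #|V|; elim: m V => // m IH V ltm.
have [[u [uu su uV au]]|noP] := EM (long_path V a); last first.
  by exists set0; rewrite ?setD0 // cards0 mul0n.
case: u au uu su uV => [|x u] au uu su uV; first by move: au a_gt0; case: (a).
have xV : x \in V by apply: uV; rewrite mem_head.
have [|||||X0 [C0 [cX0 aC0 C0V sep noP0]]] :=
  @piece_from_path V (component V x) [::] x isT isT _ _ _ (component_connected xV).
- by rewrite inE xV connect0.
- by apply/subsetP => y; rewrite inE => /andP[].
- by [].
- apply: leq_trans au _; rewrite -(card_uniqP uu); apply/subset_leq_card/subsetP => y yu.
  by rewrite inE uV //=; apply: path_connect yu; apply: (sorted_within uV).
- move=> y z; rewrite !inE orbF => /andP[yV cy] zV eyz; rewrite zV.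
  by apply: connect_trans cy (connect1 _); rewrite /within yV zV.
have [|X1 cX1 noP1] := IH (V :\: (C0 :|: X0)).
  rewrite ltnS in ltm; apply: leq_trans ltm; apply/proper_card/properP.
  split; first exact: subsetDl.
  have /card_gt0P[y yC0] : (0 < #|C0|)%N by apply: leq_trans aC0.
  by exists y; rewrite ?(subsetP C0V) // !inE yC0.
exists (X0 :|: X1).
  have cU : (#|X0 :|: X1| <= #|X0| + #|X1|)%N by rewrite cardsU leq_subr.
  apply: leq_trans (leq_mul cU (leqnn a)) _; rewrite mulnDl.
  have cV : (#|C0| + #|V :\: (C0 :|: X0)| <= #|V|)%N.
    rewrite -(cardsID C0 V) (setIidPr C0V) leq_add2l; apply/subset_leq_card.
    by rewrite -setDDl subsetDl.
  apply: leq_trans (leq_mul (leqnn t) cV); rewrite mulnDr leq_add //.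
  exact: leq_mul.
case=> w [uw sw wV aw].
have [||wC|wC] := @sorted_stay (C0 :\: X0) (V :\: X0) w _ sw.
- by move=> z /wV; rewrite !inE negb_or => /andP[/andP[-> _] ->].
- move=> y z yC zV eyz; have := sep y z yC zV eyz.
  by move: zV; rewrite !inE => /andP[-> _] ->.
- by apply: noP0; exists w.
apply: noP1; exists w; split=> // z zw.
have := wC z zw; have := wV z zw; rewrite !inE !negb_or negb_and negbK.
by move=> /andP[/andP[zX0 zX1] zV]; rewrite (negPf zX0) zX1 zV /= => ->.
Qed.

End Separator.

(** * Acyclic graphs *)

Section Acyclic.
Variables (T : finType) (e : rel T).
Hypothesis e_irr : irreflexive e.
Hypothesis acyclic : forall s, ucycle e s -> (size s < 3)%N.
Implicit Types (S W : {set T}).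

(** The end of a path that cannot be prolonged in W has all its neighbours in W on
the path, and only its predecessor does not close a cycle. *)
Lemma leaf W : W != set0 -> exists2 v, v \in W & (#|[set z in W | e v z]| <= 1)%N.
Proof.
case/set0Pn => v0 v0W.
suff ext P v : sorted e (rcons P v) -> uniq (rcons P v) -> {subset rcons P v <= W} ->
    exists2 v, v \in W & (#|[set z in W | e v z]| <= 1)%N.
  by apply: (@ext [::] v0) => // z; rewrite inE => /eqP ->.
have [m] := ubnP (#|T| - size P); elim: m P v => // m IH P v ltm sP uP PW.
have vW : v \in W by apply: PW; rewrite mem_rcons mem_head.
have [/existsP[z /and3P[zW evz zP]]|none] :=
  boolP [exists z, [&& z \in W, e v z & z \notin rcons P v]].
  apply: (IH (rcons P v) z).
  - have : (size (rcons P v) <= #|T|)%N by rewrite -(card_uniqP uP) max_card.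
    rewrite size_rcons => leP.
    by rewrite subnS -ltnS prednK // subn_gt0.
  - case: P {ltm uP PW zP} sP => [|p0 P] /=; first by rewrite evz.
    by move=> sP; rewrite rcons_path sP last_rcons.
  - by rewrite rcons_uniq zP.
  - by move=> w; rewrite mem_rcons inE => /orP[/eqP ->|/PW].
exists v => //; apply: (@leq_trans #|[set last v P]|); last by rewrite cards1.
apply/subset_leq_card/subsetP => z; rewrite !inE => /andP[zW evz].
have zP : z \in P.
  have := none; rewrite negb_exists => /forallP/(_ z); rewrite zW evz negbK mem_rcons inE.
  by case/orP => // /eqP zv; rewrite zv e_irr in evz.
move: uP; rewrite rcons_uniq => /andP[vP uP].
case/splitPr: zP sP uP vP PW => P1 P2 sP uP vP _.
have conv : connected e [set v].
  by move=> x y; rewrite !inE => /eqP -> /eqP ->; apply: connect0.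
have [|s /acyclic lts les] := close_cycle sP uP _ conv (set11 v) (set11 v) evz.
  by move=> w; rewrite inE; apply: contraTneq => ->.
case: P2 sP uP vP les => [|w P2] _ _ _ les; first by rewrite last_cat.
by have := leq_ltn_trans les lts; rewrite addn2.
Qed.

(** Peeling off leaves one by one, each new vertex contributes at most one
vertex to the neighbourhood. *)
Lemma small_nbhd j : (j <= #|T|)%N -> exists2 S : {set T}, #|S| = j &
  (#|[set v | (v \notin S) && [exists u in S, e u v]]| <= j)%N.
Proof.
elim: j => [|j IH] lej.
  exists set0; rewrite ?cards0 // leqn0 cards_eq0; apply/eqP/setP => v; rewrite !inE.
  by apply/existsP => -[u]; rewrite inE.
have [S cS nS] := IH (ltnW lej).
have [|v vS dv] := @leaf (~: S).
  by rewrite -card_gt0 -subn_gt0 -(addKn #|S| #|~: S|) cardsC cS subn0 subn_gt0.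
rewrite inE in vS.
exists (v |: S); first by rewrite cardsU1 vS cS.
rewrite -addn1; apply: leq_trans (leq_add nS dv).
apply: leq_trans (leq_card_setU _ _).1.
apply/subset_leq_card/subsetP => z; rewrite !inE negb_or => /andP[/andP[zv zS]].
case/existsP=> u /andP[]; rewrite !inE => /orP[/eqP -> ->|uS euz]; first by rewrite zS orbT.
by rewrite zS /=; apply/orP; left; apply/existsP; exists u; rewrite uS.
Qed.

End Acyclic.

(** * Average neighbourhoods of k-subsets *)

Section Average.
Variables (R : realType) (T : finType).
Implicit Types (S W Z : {set T}) (E : {set {set T}}).

(** Factor by factor, since (N - i - x) / (N - i) >= (r - x) / r for
N - i >= r. *)
Lemma ffact_shift_le (N x k r : nat) : (x <= r)%N -> (r + k <= N)%N ->
  (N ^_ k * (r - x) ^ k <= (N - x) ^_ k * r ^ k)%N.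
Proof.
move=> lexr; elim: k => [|k IH] lek; first by rewrite !ffactn0 !expn0.
rewrite !ffactnSr !expnSr.
have le1 : (r + k <= N)%N by apply: leq_trans lek; rewrite addnS leqnSn.
have := leq_mul (IH le1) (_ : (N - k) * (r - x) <= (N - x - k) * r)%N.
rewrite [X in _ -> (X <= _)%N]mulnACA [X in _ -> (_ <= X)%N]mulnACA; apply.
have rN : (r <= N - k)%N by rewrite leq_subRL ?(leq_trans (leq_addl r k)) // addnC.
rewrite (subnAC N x k) mulnBr [X in (_ <= X)%N]mulnBl.
by apply: leq_sub2l; rewrite mulnC leq_mul2r rN orbT.
Qed.

Lemma bernoulli (z : R) k : -1 <= z -> 1 + k%:R * z <= (1 + z) ^+ k.
Proof.
move=> z1; elim: k => [|k IH]; first by rewrite mul0r addr0 expr0.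
have k0 : 0 <= k%:R :> R by [].
rewrite exprSr -natr1.
apply: le_trans (ler_wpM2r _ IH); last by lra.
by rewrite -subr_ge0; have := mulr_ge0 k0 (sqr_ge0 z); rewrite expr2; nra.
Qed.

(** The tangent to z ^+ k at z0. *)
Lemma tangent_le (z z0 : R) k : 0 <= z -> 0 < z0 ->
  z0 ^+ k.+1 + k.+1%:R * z0 ^+ k * (z - z0) <= z ^+ k.+1.
Proof.
move=> z_ge0 z0_gt0.
have := @bernoulli (z / z0 - 1) k.+1 _.
rewrite subrKC expr_div_n ler_pdivlMr ?exprn_gt0 // => H.
apply: le_trans (H _); last by rewrite lerBrDr addNr divr_ge0 // ltW.
rewrite exprS le_eqVlt; apply/orP; left; apply/eqP; field.
by rewrite gt_eqF.
Qed.

Lemma bin_ratio_ge (N x k r : nat) (z0 : R) : (x <= N)%N -> (r + k.+1 = N)%N ->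
  (0 < r)%N -> 0 < z0 -> z0 <= 1 ->
  ('C(N, k.+1)%:R : R) * (z0 ^+ k.+1 + k.+1%:R * z0 ^+ k * (1 - x%:R / r%:R - z0))
    <= 'C(N - x, k.+1)%:R.
Proof.
move=> lexN rN r0 z0_gt0 z0_le1.
have rR : 0 < r%:R :> R by rewrite ltr0n.
have [lexr|ltrx] := leqP x r; last first.
  apply: le_trans (ler0n _ _); apply: mulr_ge0_le0; first exact: ler0n.
  have x1 : 1 <= x%:R / r%:R :> R by rewrite ler_pdivlMr // mul1r ler_nat ltnW.
  have z0k : 0 <= z0 ^+ k by rewrite exprn_ge0 // ltW.
  have k1 : 1 <= k.+1%:R :> R by rewrite ler1n.
  rewrite exprS (mulrC k.+1%:R) -mulrA (mulrC z0) -mulrDr.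
  apply: mulr_ge0_le0 => //; nra.
have z_ge0 : 0 <= 1 - x%:R / r%:R :> R.
  by rewrite subr_ge0 ler_pdivrMr // mul1r ler_nat.
apply: le_trans (ler_wpM2l (ler0n _ _) (tangent_le k z_ge0 z0_gt0)) _.
have -> : 1 - x%:R / r%:R = (r - x)%:R / r%:R :> R.
  by rewrite natrB // mulrBl divff // gt_eqF.
rewrite expr_div_n mulrA ler_pdivrMr ?exprn_gt0 // -!natrX -!natrM ler_nat.
rewrite -(leq_pmul2r (fact_gt0 k.+1)) mulnAC bin_ffact mulnAC bin_ffact.
by apply: ffact_shift_le => //; rewrite rN.
Qed.

(** Double counting of the pairs formed by a k-subset Z of S and a vertex w that Z
sees.  A vertex with x neighbours in S is missed by a random Z with probability
at least (1 - x / r) ^ k by bin_ratio_ge.  This is convex in x, so it may be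
replaced by its tangent, which turns the average over Z into a bound that is
linear in the number of edges.  The free parameter z0 is the point of tangency. *)
Lemma cut_average E S W (k r : nat) (z0 m : R) :
  #|S| = (r + k.+1)%N -> (0 < r)%N -> 0 < z0 -> z0 <= 1 ->
  (forall Z : {set T}, Z \subset S -> #|Z| = k.+1 ->
     m <= #|[set w in W | [exists z in Z, adj E z w]]|%:R) ->
  m <= #|W|%:R * (1 - z0 ^+ k.+1 - k.+1%:R * z0 ^+ k * (1 - z0)) +
       k.+1%:R * z0 ^+ k * (cut_size E S W)%:R / r%:R.
Proof.
move=> cS r0 z0_gt0 z0_le1 mZ.
have B0 : 0 < 'C(#|S|, k.+1)%:R :> R by rewrite ltr0n bin_gt0 cS leq_addl.
rewrite -(ler_pM2l B0).
pose ZZ := [set Z : {set T} | (Z \subset S) && (#|Z| == k.+1)].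
have cZZ : #|ZZ| = 'C(#|S|, k.+1) by rewrite cards_draws.
have le1 : 'C(#|S|, k.+1)%:R * m <=
    \sum_(Z in ZZ) #|[set w in W | [exists z in Z, adj E z w]]|%:R.
  rewrite -cZZ mulr_natl -sumr_const; apply: ler_sum => Z.
  by rewrite inE => /andP[sZ /eqP cZ]; apply: mZ.
apply: le_trans le1 _; rewrite -natr_sum.
pose d w := #|[set s in S | adj E s w]|.
have -> : (\sum_(Z in ZZ) #|[set w in W | [exists z in Z, adj E z w]]| =
    \sum_(w in W) ('C(#|S|, k.+1) - 'C(#|S| - d w, k.+1)))%N.
  under eq_bigr do rewrite -sum1_card.
  rewrite (exchange_big_dep (fun w => w \in W)) /=; last first.
    by move=> Z w _; rewrite inE => /andP[].
  apply: eq_bigr => w wW; rewrite sum1_card.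
  pose NZ := [set Z : {set T} | (Z \subset S :\: [set s in S | adj E s w]) && (#|Z| == k.+1)].
  have <- : #|NZ| = 'C(#|S| - d w, k.+1).
    rewrite cards_draws cardsDS //; apply/subsetP => s; by rewrite inE => /andP[].
  rewrite -cZZ -cardsDS; last first.
    apply/subsetP => Z; rewrite !inE => /andP[sZ ->]; rewrite andbT.
    exact: subset_trans sZ (subsetDl _ _).
  apply: eq_card => Z; rewrite [LHS]unfold_in !inE wW /=.
  case: (#|Z| == k.+1); rewrite ?andbF ?andbT //=.
  have [sZ|] := boolP (Z \subset S); rewrite ?andbF ?andbT //=.
  apply/idP/idP.
    case/existsP=> z /andP[zZ azw]; apply/negP => /subsetP/(_ z zZ).
    by rewrite !inE azw (subsetP sZ z zZ).
  apply: contraR; rewrite negb_exists => /forallP nz; apply/subsetP => z zZ.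
  rewrite !inE (subsetP sZ z zZ) andbT /=.
  by have := nz z; rewrite zZ.
rewrite natr_sum /cut_size natr_sum.
set B := 'C(#|S|, k.+1)%:R; set K := k.+1%:R * z0 ^+ k; set A := 1 - _ - _.
have -> : B * (#|W|%:R * A + K * (\sum_(w in W) (d w)%:R) / r%:R) =
    \sum_(w in W) B * (A + K * (d w)%:R / r%:R).
  rewrite -mulr_sumr big_split /= sumr_const; congr (_ * (_ + _)).
    by rewrite mulr_natl.
  by rewrite mulr_sumr mulr_suml.
apply: ler_sum => w wW.
have ledN : (d w <= #|S|)%N by apply/subset_leq_card/subsetP => s; rewrite inE => /andP[].
rewrite natrB; last exact/leq_bin2l/leq_subr.
have := bin_ratio_ge ledN (esym cS) r0 z0_gt0 z0_le1; rewrite -/B => H.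
by rewrite lerBlDl -lerBlDr; apply: le_trans H; rewrite /A /K le_eqVlt; apply/orP; left; apply/eqP; ring.
Qed.

(** Bernoulli's inequality for both halves of the exponent gives the quadratic
term. *)
Lemma exprn_frac_ge (c : R) k : (2 <= k)%N -> 0 < c -> c < 1 ->
  1 - c + 2 / 9 * c ^+ 2 <= (1 - c / k%:R) ^+ k.
Proof.
move=> k2 c0 c1; pose b := k./2; pose b' := uphalf k.
have kE : (k = b + b')%N by rewrite /b' uphalf_half addnCA addnn odd_double_half.
have bb : (2 * (k * k) <= 9 * (b * b'))%N.
  have b1 : (0 < b)%N by rewrite half_gt0.
  rewrite /b' uphalf_half -/b -[in leqLHS](odd_double_half k) -/b.
  by case: (odd k); move: b1; clear; case: b => // b _; nia.
have kR : 0 < k%:R :> R by rewrite ltr0n ltnW.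
set q := c / k%:R.
have q0 : 0 < q by rewrite divr_gt0.
have qk : k%:R * q = c by rewrite mulrC divfK // gt_eqF.
have q1 : - 1 <= - q.
  by rewrite lerN2 ler_pdivrMr // mul1r (le_trans (ltW c1)) // ler1n ltnW.
have bq (j : nat) : (j <= k)%N -> 0 <= 1 - j%:R * q.
  move=> jk; rewrite subr_ge0; apply: le_trans (ltW c1).
  by rewrite -qk ler_wpM2r ?ler_nat // ltW.
have B j : (j <= k)%N -> 1 - j%:R * q <= (1 - q) ^+ j.
  by move=> jk; have := bernoulli j q1; rewrite mulrN.
have lb : (b <= k)%N by rewrite kE leq_addr.
have lb' : (b' <= k)%N by rewrite kE leq_addl.
apply: le_trans (_ : (1 - b%:R * q) * (1 - b'%:R * q) <= _); last first.
  by rewrite [in leRHS]kE exprD; apply: ler_pM (B _ _) (B _ _); rewrite ?bq.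
have : 2 * k%:R ^+ 2 <= 9 * (b%:R * b'%:R) :> R by rewrite -natrX -!natrM ler_nat.
have k2q : k%:R ^+ 2 * q ^+ 2 = c ^+ 2 by rewrite -exprMn qk.
move=> /(ler_wpM2r (sqr_ge0 q)) H; rewrite -(mulrA 2) k2q -(mulrA 9) in H.
have bq' : b%:R * q + b'%:R * q = c by rewrite -mulrDl -natrD -kE.
have -> : (1 - b%:R * q) * (1 - b'%:R * q) = 1 - c + b%:R * b'%:R * q ^+ 2.
  by rewrite -bq'; ring.
by move: H; rewrite -(mulrA (b%:R)); move: (c ^+ 2) (_ * (_ * q ^+ 2)) => u v; lra.
Qed.

(** Splitting S into k-subsets only gives about #|S| c n / k boundary edges; the
term c ^ 2 / 18 is the gain.  It exists because, in a set of n vertices, the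
vertices seen by a random k-subset, a proportion c, are often seen twice.  For
k = 1 there is no gain, as disjoint unions of cliques show. *)
Lemma cut_gain E S W (n k : nat) (c l : R) :
  (2 <= k)%N -> (k < #|S|)%N -> (#|W| <= n)%N -> (0 < n)%N -> 0 < c -> c < 1 ->
  l <= c ^+ 2 / 9 ->
  (forall Z : {set T}, Z \subset S -> #|Z| = k ->
     (c - l) * n%:R <= #|[set w in W | [exists z in Z, adj E z w]]|%:R) ->
  (#|S| - k)%:R * (n%:R / k%:R) * (c + c ^+ 2 / 18) <= (cut_size E S W)%:R.
Proof.
case: k => // k; rewrite ltnS => k0 ltk leW n0 c0 c1 ll mZ.
(* tangency at x / r = c / k, where a vertex is seen with probability about c *)
set z0 : R := 1 - c / k.+1%:R.
have k2 : 2 <= k.+1%:R :> R by rewrite ler_nat.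
have kR : 0 < k.+1%:R :> R by rewrite ltr0n.
have ck : c / k.+1%:R <= c / 2 by rewrite ler_pM2l // lef_pV2 // ?posrE.
have ck0 : 0 < c / k.+1%:R by rewrite divr_gt0.
have z0_gt : 1 / 2 < z0 by rewrite /z0; move: (c / k.+1%:R) ck ck0 => q; lra.
have z0_gt0 : 0 < z0 by apply: lt_trans z0_gt; rewrite divr_gt0.
have z0_le1 : z0 <= 1 by rewrite lerBlDr lerDl ltW.
have [r rE] : exists r, (#|S| = r + k.+1)%N by exists (#|S| - k.+1)%N; rewrite subnK // ltnW.
have r0 : (0 < r)%N by move: ltk; rewrite rE -[X in (X < _)%N]add0n ltn_add2r.
have rR : 0 < r%:R :> R by rewrite ltr0n.
have nR : 0 < n%:R :> R by rewrite ltr0n.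
have := cut_average rE r0 z0_gt0 z0_le1 mZ.
set X := (cut_size _ _ _)%:R; set Z := z0 ^+ k => avg.
have Z0 : 0 < Z by rewrite exprn_gt0.
have kz : k.+1%:R * (1 - z0) = c by rewrite /z0 opprB addrC subrK mulrC divfK // gt_eqF.
have zk : 1 - c + 2 / 9 * c ^+ 2 <= z0 * Z.
  by rewrite -exprS; apply: exprn_frac_ge.
have A0 : 0 <= 1 - z0 ^+ k.+1 - k.+1%:R * Z * (1 - z0).
  have := tangent_le k ler01 z0_gt0; rewrite expr1n -/Z; lra.
have avg2 : (c - l) * n%:R <= n%:R * (1 - z0 ^+ k.+1 - k.+1%:R * Z * (1 - z0))
    + k.+1%:R * Z * X / r%:R.
  by apply: le_trans avg _; rewrite lerD2r ler_wpM2r // ler_nat.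
have -> : (#|S| - k.+1)%N = r by rewrite rE addnK.
pose Q := X * k.+1%:R / (r%:R * n%:R).
suff : c + c ^+ 2 / 18 <= Q.
  rewrite /Q ler_pdivlMr ?mulr_gt0 // => H.
  rewrite mulrA -mulrA (mulrC k.+1%:R^-1) !mulrA ler_pdivrMr //.
  by apply: le_trans H; rewrite mulrC mulrA.
have avg3 : c - l <= 1 - z0 * Z - Z * c + Z * Q.
  rewrite -(ler_pM2r nR); apply: le_trans avg2 _; rewrite le_eqVlt; apply/orP; left; apply/eqP.
  rewrite /Q -[in RHS]kz exprS -/Z; field.
  by rewrite !gt_eqF.
have c2 : c ^+ 2 <= c by rewrite expr2 ger_pMr // ltW.
have zc : z0 * Z * (1 - c ^+ 2 / 9) >= 1 - c + l.
  apply: (@le_trans _ _ ((1 - c + 2 / 9 * c ^+ 2) * (1 - c ^+ 2 / 9))).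
    have : 0 <= c ^+ 2 by rewrite sqr_ge0.
    move: c2 ll; set b := c ^+ 2; nra.
  by apply: ler_wpM2r zk; lra.
have : Z * (c + z0 * (c ^+ 2 / 9)) <= Z * Q by lra.
rewrite ler_pM2l // => H; apply: le_trans H.
have : 0 <= c ^+ 2 by rewrite sqr_ge0.
move: z0_gt; set b := c ^+ 2; nra.
Qed.

End Average.

(** * Exponential estimates *)

Section Estimates.
Variable R : realType.

(** The bound of adaptive_tail when P0 edges are found and N0 missed, although odds
rho let one expect (1 + dlt) P0 edges with that many missed.  To first order in
th = dlt / 8 the exponent is - th dlt P0; the second-order terms add at most
4 th ^ 2 P0, half of this. *)
Lemma chernoff_exp (dlt rho : R) (P0 N0 : nat) :
  0 < dlt -> dlt <= 1 -> 0 <= rho -> rho <= 1 ->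
  (1 + dlt) * P0%:R <= rho * N0%:R ->
  (1 - dlt / 8) ^- P0 * (1 + dlt / 8 * rho) ^- N0 <= expR (- (dlt ^+ 2 / 16 * P0%:R)).
Proof.
move=> d0 d1 r0 r1 gain; set th := dlt / 8.
have th0 : 0 < th by rewrite /th; lra.
have th1 : th <= 1 / 8 by rewrite /th; lra.
have tr0 : 0 <= th * rho by rewrite mulr_ge0 // ltW.
have tr1 : th * rho <= th by rewrite ger_pMr.
have tr1' : 1 <= 1 + th * rho by rewrite lerDl.
have x_le : (1 - th)^-1 <= expR (th + 2 * th ^+ 2).
  apply: le_trans (expR_ge1Dx _); rewrite -[leLHS]mul1r ler_pdivrMr; last by lra.
  rewrite expr2; nra.
have y_le : (1 + th * rho)^-1 <= expR (- (th * rho * (1 - th))).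
  have u0 : 0 < 1 + th * rho by lra.
  have -> : (1 + th * rho)^-1 = 1 - th * rho / (1 + th * rho).
    by field; rewrite gt_eqF.
  apply: le_trans (expR_ge1Dx _) _; rewrite ler_expR lerN2; apply: ler_wpM2l => //.
  by rewrite -[leRHS]mul1r ler_pdivlMr //; nra.
rewrite -!exprVn.
apply: le_trans (_ : expR (th + 2 * th ^+ 2) ^+ P0 *
    expR (- (th * rho * (1 - th))) ^+ N0 <= _).
  by apply: ler_pM; rewrite ?exprn_ge0 ?invr_ge0 //; try lra; apply: lerXn2r;
    rewrite ?nnegrE ?invr_ge0 ?expR_ge0 //; lra.
rewrite -!expRM_natl -expRD ler_expR.
have P0R : 0 <= P0%:R :> R by [].
have H : th * (1 - th) * ((1 + dlt) * P0%:R) <= th * (1 - th) * (rho * N0%:R).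
  by apply: ler_wpM2l => //; apply: mulr_ge0; lra.
have dE : dlt = 8 * th by rewrite /th; lra.
have -> : N0%:R * - (th * rho * (1 - th)) = - (th * (1 - th) * (rho * N0%:R)) by ring.
rewrite dE in H *.
have th2 : th ^+ 2 * th <= th ^+ 2 * (1 / 8) by rewrite ler_wpM2l // sqr_ge0.
have := ler_wpM2r P0R th2; rewrite !expr2.
move: (P0%:R) P0R H => x x0; move: (rho * N0%:R) => y; lra.
Qed.

(** The constants are such that the bound holds from n = 1 on: with z = exp (- g)
the point is z ^ n (2 - z ^ n) <= (z (2 - z)) ^ n. *)
Lemma two_rounds (g : R) : 0 < g ->
  exists2 gam, 0 < gam & forall n : nat, (0 < n)%N ->
    1 - expR (- (gam * n%:R)) <= (1 - expR (- (g * n%:R))) ^+ 2.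
Proof.
move=> g0; set z := expR (- g).
have z0 : 0 < z by rewrite expR_gt0.
have z1 : z < 1 by rewrite expR_lt1 oppr_lt0.
have w0 : 0 < z * (2 - z) by rewrite mulr_gt0 //; lra.
have w1 : z * (2 - z) < 1 by nra.
exists (- ln (z * (2 - z))); first by rewrite oppr_gt0 ln_lt0 // w0.
move=> n n0; rewrite mulNr opprK mulrC expRM_natl lnK ?posrE //.
have -> : expR (- (g * n%:R)) = z ^+ n by rewrite -expRM_natl mulrN mulrC.
have zn k : 0 <= z ^+ k <= 1 by rewrite exprn_ge0 ?exprn_ile1 // ltW.
suff : z ^+ n * (2 - z ^+ n) <= (z * (2 - z)) ^+ n by rewrite expr2; lra.
rewrite exprMn; apply: ler_wpM2l; first by case/andP: (zn n).
elim: n n0 => // -[|n] IH _; first by rewrite !expr1.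
rewrite [X in _ <= X]exprS; apply: le_trans (ler_wpM2l _ (IH isT)); last by lra.
rewrite exprS; have := zn n.+1; move: (z ^+ n.+1) => u /andP[u0 u1]; nra.
Qed.

(** A random set of density q equals any given set of size at most m with
probability at least q ^ m (1 - q) ^ n, and these probabilities sum to at most
1. *)
Lemma few_small_sets (T : finType) (m q : R) : 0 < q -> q <= 1 / 2 ->
  #|[set X : {set T} | #|X|%:R <= m]|%:R <= expR (m / q + 2 * q * #|T|%:R).
Proof.
move=> q0 q1; have q01 : 0 <= q <= 1 by apply/andP; split; lra.
have qe : expR (- q^-1) <= q.
  rewrite expRN -[leRHS]invrK lef_pV2 ?posrE ?expR_gt0 ?invr_gt0 //.
  by apply: le_trans (expR_ge1Dx _); rewrite lerDr.
have q'e : expR (- (2 * q)) <= 1 - q.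
  rewrite expRN -[leLHS]mul1r ler_pdivrMr ?expR_gt0 //.
  apply: le_trans (ler_wpM2l _ (expR_ge1Dx _)); last by lra.
  by nra.
set N := #|_|; set b := expR (- (m / q + 2 * q * #|T|%:R)).
suff : N%:R * b <= 1 by rewrite /b expRN ler_pdivrMr ?expR_gt0 // mul1r.
rewrite -[leRHS](expect_cst [set: T] q) /expect.
rewrite mulr_natl -sumr_const /=.
apply: le_trans (_ : \sum_(X in [set X : {set T} | #|X|%:R <= m])
    subset_weight [set: T] q X * 1 <= _); last first.
  rewrite [leRHS](bigID (fun X : {set T} => #|X|%:R <= m)) /=.
  rewrite (eq_bigl (fun X : {set T} => (X \subset [set: T]) && (#|X|%:R <= m))); last first.
    by move=> X; rewrite inE subsetT.
  by rewrite lerDl; apply: sumr_ge0 => X _; rewrite mulr1 subset_weight_ge0.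
apply: ler_sum => X; rewrite inE mulr1 => Xm.
have -> : subset_weight [set: T] q X = q ^+ #|X| * (1 - q) ^+ #|~: X|.
  rewrite /subset_weight (bigID (fun x => x \in X)) /=; congr (_ * _).
    rewrite (eq_bigr (fun=> q)) => [|x /andP[_ ->]] //.
    by rewrite prodr_const; congr (_ ^+ _); apply: eq_card => x; rewrite [LHS]unfold_in ?inE.
  rewrite (eq_bigr (fun=> 1 - q)) => [|x /andP[_ /negPf ->]] //.
  by rewrite prodr_const; congr (_ ^+ _); apply: eq_card => x; rewrite [LHS]unfold_in ?inE.
rewrite /b opprD expRD; apply: ler_pM; rewrite ?expR_ge0 //.
  apply: le_trans (_ : expR (- q^-1) ^+ #|X| <= _).
    by rewrite -expRM_natl ler_expR mulrN lerN2 ler_pM2r // invr_gt0.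
  by apply: lerXn2r; rewrite ?nnegrE ?expR_ge0 // ltW.
apply: le_trans (_ : (1 - q) ^+ #|T| <= _); last first.
  by apply: ler_wiXn2l; rewrite ?max_card //; lra.
rewrite -mulNr mulrC expRM_natl; apply: lerXn2r; rewrite ?nnegrE ?expR_ge0 //; lra.
Qed.

End Estimates.

(** * Robust long paths force a long cycle *)

Lemma large_d_arith (R : realType) (c dlt N k l : R) : 0 < c -> c <= 1 ->
  0 <= k -> 0 <= l -> 0 < N -> dlt <= c / 100 -> k <= c / 100 * N -> l <= c / 100 * N ->
  (1 + dlt) * (N + l) <= (N - k) * (1 + c / 18).
Proof.
move=> c0 c1 k0 l0 N0 dc kN lN.
have cN : c * N <= N by rewrite ger_pMl.
have D1 : dlt * (N + l) <= c / 100 * (N + l) by rewrite ler_wpM2r //; lra.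
have D2 : c * (N + l) <= c * (2 * N) by apply: ler_wpM2l; lra.
have D3 : c * k <= k by rewrite ler_piMl.
have D4 : 0 < c * N by rewrite mulr_gt0.
lra.
Qed.

Section Robust.
Variables (R : realType) (T : finType) (E : {set {set T}}).
Implicit Types (S U W X Z : {set T}).

Lemma nat_ceil (v : R) : exists N : nat,
  v <= N%:R /\ forall m : nat, v <= m%:R -> (N <= m)%N.
Proof.
have ex : exists m : nat, v <= m%:R.
  by exists (Num.truncn v).+1; apply/ltW/truncnS_gt.
by case: (ex_minnP ex) => N vN min; exists N.
Qed.

(** Any rho below the odds p / (1 - p) makes 1 + rho dlt / 8 an admissible weight
for a missed edge. *)
Lemma dfs_exp X (s0 l0 : nat) (p dlt rho : R) :
  0 <= p <= 1 -> 0 < dlt -> dlt <= 1 -> 0 < rho -> rho <= 1 -> (1 - p) * rho <= p ->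
  (s0 + l0 + #|X| < #|T|)%N ->
  (forall S U, #|S| = s0 -> (#|U| <= l0)%N -> [disjoint S & X] ->
     (1 + dlt) * (s0 + l0)%:R <= rho * (cut_size E S (~: (S :|: U :|: X)))%:R) ->
  Pr E p (fun F => ~ has_path F X l0.+1) <= expR (- (dlt ^+ 2 / 16 * (s0 + l0)%:R)).
Proof.
move=> p01 d0 d1 r0 r1 pr big gain.
have [N0 [gN0 minN0]] := nat_ceil ((1 + dlt) * (s0 + l0)%:R / rho).
have := chernoff_exp d0 d1 (ltW r0) r1 (_ : (1 + dlt) * (s0 + l0)%:R <= rho * N0%:R).
rewrite -ler_pdivrMl // mulrC => /(_ gN0); apply: le_trans.
have x0 : 0 <= dlt / 8 * rho by rewrite mulr_ge0 ?ltW // divr_gt0.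
apply: dfs_tail => //; rewrite ?lerDl //; try lra.
  have : dlt / 8 * ((1 - p) * rho) <= dlt / 8 * p by rewrite ler_wpM2l // ltW // divr_gt0.
  lra.
by move=> S U cS cU dSX; apply: minN0; rewrite ler_pdivrMr // [leRHS]mulrC; apply: gain.
Qed.

Lemma prob_GpE (p : R) (A : {set {set T}} -> Prop) : prob_Gp E p A = Pr E p A.
Proof.
rewrite /prob_Gp big_mkcondr; apply: eq_bigr => F _.
by case: asbool; rewrite ?mulr1 ?mulr0.
Qed.

Definition has_cycle (t : nat) (F : {set {set T}}) :=
  exists s, is_graph_cycle F s /\ (t <= size s)%N.

(** If F has no long cycle, then some small set X meets all paths of a
vertices, so that a union bound over X reduces long cycles to long paths. *)
Lemma robust_path_cycle (t a : nat) (p m B : R) :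
  0 <= p <= 1 -> (0 < a)%N -> (3 <= t)%N -> (t * #|T|)%:R <= m * a%:R ->
  (forall X, #|X|%:R <= m -> Pr E p (fun F => ~ has_path F X a) <= B) ->
  Pr E p (fun F => ~ has_cycle t F) <= #|[set X : {set T} | #|X|%:R <= m]|%:R * B.
Proof.
move=> p01 a0 t3 tm pathB.
apply: le_trans (_ : \sum_(X : {set T} | #|X|%:R <= m) Pr E p (fun F => ~ has_path F X a) <= _).
  apply: Pr_union => // F sF noC.
  have noC' s : ucycle (adj F) s -> (size s < t)%N.
    move=> cs; rewrite ltnNge; apply/negP => ts; apply: noC; exists s; split=> //.
    by split=> //; apply: leq_trans ts.
  have [X cX noP] := separator (adjC F) a0 noC' [set: T].
  exists X; last first.
    case=> u [uu su uX au]; apply: noP; exists u; split=> // z /uX.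
    by rewrite !inE andbT.
  have aR : 0 < a%:R :> R by rewrite ltr0n.
  rewrite -(ler_pM2r aR); apply: le_trans tm.
  by rewrite -natrM ler_nat -[#|T|]cardsT.
apply: le_trans (ler_sum _ (fun X (h : #|X|%:R <= m) => pathB X h)) _.
by rewrite sumr_const mulr_natl cardsE.
Qed.

Lemma cut_size_nbhd S U X : (#|ext_nbhd E S| <=
  cut_size E S (~: (S :|: U :|: X)) + (#|U| + #|X|))%N.
Proof.
set W := ~: _.
apply: leq_trans (_ : #|ext_nbhd E S :&: W| + #|U :|: X| <= _)%N; last first.
  apply: leq_add; last exact: (leq_card_setU _ _).1.
  rewrite -sum1_card (eq_bigl (fun w => (w \in W) && (w \in ext_nbhd E S))); last first.
    by move=> w; rewrite inE andbC.
  rewrite /cut_size big_mkcondr /=; apply: leq_sum => w _; case: ifP => //.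
  rewrite !inE => /andP[_ /existsP[s /andP[sS a]]].
  by rewrite card_gt0; apply/set0Pn; exists s; rewrite inE sS.
rewrite -(cardsID W (ext_nbhd E S)) leq_add2l; apply/subset_leq_card/subsetP => w.
by rewrite !inE negbK => /andP[/orP[/orP[->|->//]|->]] //=; rewrite orbT.
Qed.

Lemma card_nbhd_in Z S U X : Z \subset S ->
  (#|ext_nbhd E Z| <= #|[set w in ~: (S :|: U :|: X) | [exists z in Z, adj E z w]]|
     + (#|S| + #|U| + #|X|))%N.
Proof.
move=> ZS; set W := ~: _.
apply: leq_trans (_ : _ <= #|[set w in W | [exists z in Z, adj E z w]]| + #|S :|: U :|: X|)%N _.
  apply: leq_trans (leq_card_setU _ _).1; apply/subset_leq_card/subsetP => w.
  by rewrite !inE => /andP[_ ->]; rewrite andbT orNb.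
rewrite leq_add2l; apply: leq_trans (leq_card_setU _ _).1 _.
by rewrite leq_add2r; apply: (leq_card_setU _ _).1.
Qed.

Variables (c p : R) (d k : nat).
Hypotheses (c_gt0 : 0 < c) (c_lt1 : c < 1) (d_ge2 : (2 <= d)%N) (k_gt0 : (0 < k)%N).
Hypotheses (pd : 1 <= p * d%:R) (p_le1 : p <= 1).
Hypothesis kd : k%:R * d%:R = c * #|T|%:R.
Hypothesis expand : forall S, #|S| = k -> (d * #|S| <= #|ext_nbhd E S|)%N.
Let n : R := #|T|%:R.

Let c2_gt0 : 0 < c ^+ 2. Proof. by rewrite exprn_gt0. Qed.
Let c2_le : c ^+ 2 <= c. Proof. by rewrite expr2 ger_pMr // ltW. Qed.
Let dR : 2 <= d%:R :> R. Proof. by rewrite ler_nat. Qed.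
Let kR : 1 <= k%:R :> R. Proof. by rewrite ler1n. Qed.

Lemma p_ratio : 0 <= p <= 1 /\ (1 - p) * (d%:R - 1)^-1 <= p.
Proof.
have p0 : 0 <= p.
  by rewrite -(@pmulr_lge0 _ d%:R); [apply: le_trans pd|apply: lt_le_trans dR].
split; first by rewrite p0.
have d10 : 0 < d%:R - 1 :> R by have := dR; lra.
by rewrite ler_pdivrMr // mulrBr mulr1 lerB.
Qed.

(** When k vertices have been abandoned, about k edges have been found and about
d k missed.  This is a success rate of 1 / (d + 1), which falls short of
p >= 1 / d by a factor bounded away from 1 as long as d is bounded.  In terms of
odds, 1 / d is compared with rho = 1 / (d - 1). *)
Lemma paths_small_d X (l0 : nat) (eta : R) :
  0 < eta -> 8 * eta * d%:R <= 1 -> l0%:R <= eta * k%:R -> #|X|%:R <= eta * k%:R ->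
  Pr E p (fun F => ~ has_path F X l0.+1) <= expR (- (eta ^+ 2 / 16 * (k + l0)%:R)).
Proof.
move=> e0 ed l0k Xk.
have [p01 pr] := p_ratio; have k1 := kR; have d2 := dR; have cc := c2_le; have cc0 := c2_gt0; have c1 := c_lt1; have c0 := c_gt0.
have e1 : eta <= 1 / 16.
  by have := ler_wpM2l (ltW e0) dR; lra.
have ek : eta * k%:R <= 1 / 16 * k%:R by rewrite ler_wpM2r.
have d10 : 0 < d%:R - 1 :> R by have := dR; lra.
apply: dfs_exp pr _ _ => //; rewrite ?invr_gt0 //; try lra.
- by rewrite invr_le1 ?unitfE ?gt_eqF //; have := dR; lra.
- rewrite -(ltr_nat R) !natrD.
  have : c * n <= n by apply: ler_piMl (ltW c_lt1).
  have := ler_wpM2l (ler0n R k) dR; rewrite kd -/n; lra.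
move=> S U cS cU dSX; rewrite ler_pdivlMl //.
have := cut_size_nbhd S U X; have := expand cS; rewrite cS => le1 le2.
have := leq_trans le1 le2; rewrite -(ler_nat R) natrM !natrD => H.
have UR : #|U|%:R <= l0%:R :> R by rewrite ler_nat.
move: (cut_size _ _ _)%:R H => cu H.
have P1 : (d%:R - 1) * l0%:R <= (d%:R - 1) * (eta * k%:R) by rewrite ler_wpM2l // ltW.
have P2 : 8 * eta * d%:R * k%:R <= k%:R by rewrite -[leRHS]mul1r ler_wpM2r.
have P3 : eta * ((d%:R - 1) * l0%:R) <= 1 / 16 * ((d%:R - 1) * l0%:R).
  by rewrite ler_wpM2r // mulr_ge0 // ltW.
have e2 : 0 <= eta * k%:R by rewrite mulr_ge0 // ltW.
move: H P1 P2 P3; lra.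
Qed.

(** The difference between d and d + 1 fades for large d.  Instead the search
continues until it has abandoned N vertices, linearly many but still much fewer
than c n, and cut_gain provides the constant factor. *)
Lemma paths_large_d X (N l0 : nat) (dlt : R) :
  (2 <= k)%N -> 0 < dlt -> dlt <= c / 100 -> (0 < N)%N ->
  k%:R <= c / 100 * N%:R -> l0%:R <= c / 100 * N%:R ->
  N%:R <= c ^+ 2 / 20 * n -> #|X|%:R <= c ^+ 2 / 20 * n ->
  Pr E p (fun F => ~ has_path F X l0.+1) <= expR (- (dlt ^+ 2 / 16 * (N + l0)%:R)).
Proof.
move=> k2 dl0 dl1 N0 kN lN Nn Xn.
have [p01 pr] := p_ratio; have k1 := kR; have d2 := dR; have cc := c2_le; have cc0 := c2_gt0; have c1 := c_lt1; have c0 := c_gt0.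
have d10 : 0 < d%:R - 1 :> R by have := dR; lra.
have NR : 0 < N%:R :> R by rewrite ltr0n.
have cN : c / 100 * N%:R <= 1 / 100 * N%:R by apply: ler_wpM2r; [apply: ltW|have := c_lt1; lra].
have n0 : 0 < n.
  have := lt_le_trans NR Nn; rewrite pmulr_rgt0 // divr_gt0 //.
have c2n : c ^+ 2 * n <= n by rewrite ger_pMl //; have := c_lt1; lra.
have tot : N%:R + l0%:R + #|X|%:R <= c ^+ 2 / 9 * n by lra.
have tot' : N%:R + l0%:R + #|X|%:R < n by lra.
apply: dfs_exp pr _ _ => //; rewrite ?invr_gt0 //; try lra.
- by rewrite invr_le1 ?unitfE ?gt_eqF //; have := dR; lra.
- by rewrite -(ltr_nat R) !natrD.
move=> S U cS cU dSX; rewrite ler_pdivlMl //.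
have UR : #|U|%:R <= l0%:R :> R by rewrite ler_nat.
have kltN : (k < N)%N by rewrite -(ltr_nat R); lra.
set W := ~: _.
have := @cut_gain R T E S W #|T| k c (c ^+ 2 / 9) k2 _ _ _ c_gt0 c_lt1 (lexx _).
rewrite cS max_card => /(_ kltN isT); rewrite -(ltr0n R) -/n => /(_ n0).
have -> : n / k%:R = d%:R / c.
  have kn0 : k%:R != 0 :> R by rewrite gt_eqF //; lra.
  have cn0 : c != 0 by rewrite gt_eqF.
  by apply/eqP; rewrite eqr_div // mulrC -kd mulrC.
set cu := (cut_size _ _ _)%:R => gain.
apply: le_trans (_ : (N - k)%:R * (d%:R / c) * (c + c ^+ 2 / 18) <= _); last first.
  apply: gain => Z ZS cZ.
  have := card_nbhd_in U X ZS; have := expand cZ; rewrite cZ cS => le1 le2.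
  have := leq_trans le1 le2; rewrite -(ler_nat R) natrM !natrD (mulrC d%:R) kd -/n.
  by rewrite -/W; move: (#|[set w in W | _]|%:R) => r; lra.
have -> : (N - k)%:R * (d%:R / c) * (c + c ^+ 2 / 18) = d%:R * ((N - k)%:R * (1 + c / 18)).
  by field; rewrite gt_eqF.
apply: ler_pM.
- exact: ltW.
- by rewrite mulr_ge0 ?ler0n //; lra.
- by rewrite lerBlDr lerDl.
rewrite natrB; last exact: ltnW.
rewrite natrD.
apply: large_d_arith => //; exact: ltW.
Qed.

End Robust.

(** * Sets of at least two vertices *)

Section LargeSets.
Variable R : realType.

(** Whether c ^ 2 d is below or above 40 * 100 decides between the two sources of
long paths.  The failure probability exp (- kap n) for one set X determines how
many vertices, xi n, the set X may have for the union bound to work; in turn the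
separator has to be that small, which fixes tau = xi alpha. *)
Lemma long_cycle_large_k (c : R) : 0 < c -> c < 1 ->
  exists tau gam : R, [/\ 0 < tau, 0 < gam &
  forall (T : finType) (E : {set {set T}}) (d k t : nat) (p : R),
    (2 <= d)%N -> (2 <= k)%N -> 1 <= p * d%:R -> p <= 1 ->
    k%:R * d%:R = c * #|T|%:R -> 40 <= c ^+ 2 * #|T|%:R ->
    (forall S : {set T}, #|S| = k -> (d * #|S| <= #|ext_nbhd E S|)%N) ->
    (3 <= t)%N -> t%:R <= tau * #|T|%:R ->
    Pr E p (fun F => ~ has_cycle t F) <= expR (- (gam * #|T|%:R))].
Proof.
move=> c0 c1.
have c2_gt0 : 0 < c ^+ 2 by rewrite exprn_gt0.
have c2_le : c ^+ 2 <= c by rewrite expr2 ger_pMr // ltW.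
have D0 : 0 < 40 * 100 :> R by lra.
pose sig := c ^+ 2 * c / (40 * 100); pose dlt := c ^+ 2 / (320 * 100); pose alpha := dlt * sig.
have sig0 : 0 < sig by rewrite divr_gt0 ?mulr_gt0.
have dlt0 : 0 < dlt by rewrite divr_gt0 ?mulr_gt0.
have dlt1 : dlt <= c / 100 by rewrite /dlt; lra.
have alpha0 : 0 < alpha by rewrite mulr_gt0.
have alpha_sig : alpha <= sig by rewrite ger_pMl //; lra.
have sigc : sig <= c ^+ 2 / (40 * 100) by apply: ler_wpM2r; [rewrite invr_ge0; lra|rewrite ger_pMr // ltW].
pose kap := dlt ^+ 2 / 16 * sig; pose q := kap / 8.
have kap0 : 0 < kap by rewrite mulr_gt0 // divr_gt0 // exprn_gt0.
have kap1 : kap <= 1.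
  have d2 : dlt ^+ 2 <= 1 by apply: exprn_ile1; [exact: ltW|lra].
  apply: le_trans (_ : 1 * sig <= _); first by apply: ler_wpM2r; [exact: ltW|lra].
  by lra.
have q0 : 0 < q by rewrite divr_gt0.
pose xi := Num.min alpha (kap * q / 4).
have xi0 : 0 < xi by rewrite lt_min alpha0 divr_gt0 // mulr_gt0.
have xi_alpha : xi <= alpha by rewrite ge_min lexx.
have xi_q : xi / q <= kap / 4.
  rewrite ler_pdivrMr // (le_trans (_ : xi <= kap * q / 4)) ?ge_min ?lexx ?orbT //.
  by rewrite mulrAC.
exists (xi * alpha), (kap / 2); split; [by rewrite mulr_gt0|by rewrite divr_gt0|].
move=> T E d k t p d2 k2 pd p1 kd cn expand t3 tn.
set n : R := #|T|%:R.
have n0 : 0 <= n by rewrite ler0n.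
have p01 : 0 <= p <= 1.
  rewrite p1 andbT -(@pmulr_lge0 _ d%:R) ?(le_trans _ pd) //.
  by rewrite ltr0n ltnW.
have [l0 l0E] : exists l0, l0 = Num.truncn (alpha * n) by exists (Num.truncn (alpha * n)).
have /andP[l0_le l0_gt] : l0%:R <= alpha * n < l0.+1%:R.
  by rewrite l0E; apply: truncn_itv; rewrite mulr_ge0 // ltW.
have k0 : (0 < k)%N by apply: ltnW.
have kR : 0 < k%:R :> R by rewrite ltr0n.
have signk : sig * n = c ^+ 2 * (k%:R * d%:R) / (40 * 100) by rewrite kd /sig; field.
have Ple (X : {set T}) : #|X|%:R <= xi * n ->
    Pr E p (fun F => ~ has_path F X l0.+1) <= expR (- (kap * n)).
  move=> Xxi; have Xa : #|X|%:R <= alpha * n.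
    by apply: le_trans Xxi _; rewrite ler_wpM2r.
  have an : alpha * n <= sig * n by rewrite ler_wpM2r.
  have weaken (s0 : nat) : sig * n <= s0%:R ->
      expR (- (dlt ^+ 2 / 16 * (s0 + l0)%:R)) <= expR (- (kap * n)).
    move=> h; rewrite ler_expR lerN2 /kap -[leLHS]mulrA ler_wpM2l //.
      by rewrite divr_ge0 // sqr_ge0.
    by rewrite natrD; apply: le_trans h _; rewrite lerDl.
  have [ds|dl] := leP (c ^+ 2 * d%:R) (40 * 100).
    have sk : sig * n <= k%:R.
      by rewrite signk ler_pdivrMr // mulrCA; apply: ler_wpM2l => //; exact: ltW.
    have ak : alpha * n <= dlt * k%:R by rewrite /alpha -mulrA ler_wpM2l // ltW.
    apply: le_trans (weaken k sk).
    apply: (paths_small_d c0 c1 d2 k0 pd p1 kd expand) => //; try exact: le_trans ak.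
    by rewrite /dlt; lra.
  have ks : k%:R <= sig * n.
    by rewrite signk ler_pdivlMr // [leRHS]mulrCA; apply: ler_wpM2l; exact: ltW.
  pose N := Num.truncn (c ^+ 2 / 20 * n).
  have /andP[N_le N_gt] : N%:R <= c ^+ 2 / 20 * n < N.+1%:R.
    by apply: truncn_itv; rewrite mulr_ge0 // divr_ge0 // ltW.
  have N_ge : c ^+ 2 / 40 * n <= N%:R by move: N_gt cn; rewrite -[N.+1%:R]natr1 -/n; lra.
  have sN : sig * n <= c / 100 * N%:R.
    have -> : sig * n = c / 100 * (c ^+ 2 / 40 * n) by rewrite /sig; field.
    by rewrite ler_wpM2l // divr_ge0 // ltW.
  have N0 : 0 < N%:R :> R by move: cn N_ge; rewrite -/n; lra.
  apply: le_trans (weaken N _); last first.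
    by apply: le_trans sN _; rewrite ger_pMl //; lra.
  have c2n : alpha * n <= c ^+ 2 / 20 * n by rewrite ler_wpM2r //; lra.
  apply: (paths_large_d c0 c1 d2 k0 pd p1 kd expand) => //.
  - by rewrite -(ltr0n R).
  - exact: le_trans sN.
  - exact: le_trans (le_trans l0_le an) sN.
  - exact: le_trans c2n.
have tm : (t * #|T|)%:R <= xi * n * l0.+1%:R.
  rewrite natrM -/n; apply: le_trans (ler_wpM2r n0 tn) _.
  have -> : xi * alpha * #|T|%:R * n = xi * n * (alpha * n) by rewrite -/n; ring.
  by apply: ler_wpM2l; [rewrite mulr_ge0 // ltW|exact: ltW].
apply: le_trans (robust_path_cycle p01 (ltn0Sn l0) t3 tm Ple) _.
have q1 : q <= 1 / 2 by rewrite /q; lra.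
apply: le_trans (ler_wpM2r (expR_ge0 _) (few_small_sets T (xi * n) q0 q1)) _.
rewrite -expRD ler_expR -/n.
have : xi * n / q <= kap / 4 * n by rewrite mulrAC ler_wpM2r.
by rewrite /q; lra.
Qed.

End LargeSets.

(** * Graphs of linear minimum degree *)

Section Hit.
Variables (R : realType) (X I : finType).

Lemma miss_one_le (D1 D2 : {set X}) (p mu : R) : 0 <= p <= 1 -> mu <= 1 ->
  [disjoint D1 & D2] -> (1 - p) ^+ #|D1| <= mu -> (1 - p) ^+ #|D2| <= mu ->
  Pr (D1 :|: D2) p (fun F => F :&: D1 = set0 \/ F :&: D2 = set0) <= 1 - (1 - mu) ^+ 2.
Proof.
move=> p01 mu1 dD m1 m2.
have -> : Pr (D1 :|: D2) p (fun F => F :&: D1 = set0 \/ F :&: D2 = set0) =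
    1 - (1 - (1 - p) ^+ #|D1|) * (1 - (1 - p) ^+ #|D2|).
  rewrite PrC; congr (1 - _).
  have compl (D : {set X}) : 1 - (1 - p) ^+ #|D| =
      expect D p (fun F => 1 - (F == set0)%:R) :> R.
    rewrite -expect_empty -[X in X - _](expect_cst D p) -mulN1r -expectZ -expectD.
    by apply: eq_expect => F _; rewrite mulN1r.
  rewrite !compl -(expect_indep p _ _ dD); apply: eq_expect => F _ /=.
  case: asboolP => [nF|nnF].
    have /eqP/negPf -> : F :&: D1 <> set0 by move=> h; apply: nF; left.
    have /eqP/negPf -> : F :&: D2 <> set0 by move=> h; apply: nF; right.
    by rewrite !subr0 mulr1.
  have [_|n1] := eqVneq (F :&: D1) set0; first by rewrite subrr mul0r.
  have [_|n2] := eqVneq (F :&: D2) set0; first by rewrite subrr mulr0.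
  by case: nnF => -[h|h]; [move: n1|move: n2]; rewrite h eqxx.
rewrite lerD2l lerN2 expr2; apply: ler_pM; rewrite ?subr_ge0 //; lra.
Qed.

(** Induction on W: the elements of D1 v and D2 v are independent of the others,
and both sets are hit with probability at least (1 - mu) ^ 2. *)
Lemma miss_all_le (E : {set X}) (W : {set I}) (D1 D2 : I -> {set X}) (p mu : R) :
  0 <= p <= 1 -> 0 <= mu -> mu <= 1 ->
  (forall v, v \in W -> [/\ D1 v \subset E, D2 v \subset E, [disjoint D1 v & D2 v],
     (1 - p) ^+ #|D1 v| <= mu & (1 - p) ^+ #|D2 v| <= mu]) ->
  {in W &, forall v w, v != w -> [disjoint D1 v :|: D2 v & D1 w :|: D2 w]} ->
  Pr E p (fun F => forall v, v \in W -> F :&: D1 v = set0 \/ F :&: D2 v = set0)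
    <= (1 - (1 - mu) ^+ 2) ^+ #|W|.
Proof.
move=> p01 mu0 mu1; have nu0 : 0 <= 1 - (1 - mu) ^+ 2 by rewrite expr2; nra.
elim/set_ind: W E => [|v W vW IH] E DE dis.
  rewrite cards0 expr0 /Pr -[leRHS](expect_cst E p); apply: le_expect => // F _.
  by rewrite lern1 leq_b1.
have [sD1 sD2 dD m1 m2] := DE v (setU11 _ _).
set Dv := D1 v :|: D2 v; set E' := E :\: Dv.
have sDv : Dv \subset E by rewrite subUset sD1.
have EE : E = Dv :|: E' by rewrite -{1}(setIidPr sDv) setID.
have dE : [disjoint Dv & E'].
  by rewrite disjoint_sym disjoints_subset; apply/subsetP => z; rewrite !inE => /andP[].
rewrite cardsU1 vW [leRHS]exprS.
apply: le_trans (_ : Pr Dv p (fun F => F :&: D1 v = set0 \/ F :&: D2 v = set0) *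
   Pr E' p (fun F => forall v, v \in W -> F :&: D1 v = set0 \/ F :&: D2 v = set0) <= _);
  last first.
  apply: ler_pM; last 2 first.
  - exact: miss_one_le.
  - apply: IH => [w wW|w w' wW wW']; last by apply: dis; rewrite inE ?wW ?wW' orbT.
    have wvW : w \in v |: W by rewrite inE wW orbT.
    have [s1 s2 ? ? ?] := DE w wvW.
    have vw : v != w by apply: contraNneq vW => ->.
    have := dis v w (setU11 _ _) wvW vw; rewrite -/Dv => dvw.
    have sub (D : {set X}) : D \subset E -> D \subset D1 w :|: D2 w -> D \subset E'.
      by move=> DsE Dw; rewrite subsetD DsE disjoint_sym; apply: disjointWr Dw dvw.
    by split=> //; apply: sub; rewrite ?subsetUl ?subsetUr.
  - by apply: expect_ge0 => // F _; rewrite ler0n.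
  - by apply: expect_ge0 => // F _; rewrite ler0n.
rewrite {1}EE -(expect_indep p _ _ dE) /Pr; apply: le_expect => // F sF.
rewrite -natrM ler_nat; case: asboolP => [allF|_] /=; last by [].
rewrite !asboolT //.
- move=> w wW; have wvW : w \in v |: W by rewrite inE wW orbT.
  have sub (D : {set X}) : F :&: D = set0 -> F :&: E' :&: D = set0.
    by move=> FD; rewrite setIAC FD set0I.
  by case: (allF w wvW) => /sub; [left|right].
- have sub (D : {set X}) : F :&: D = set0 -> F :&: Dv :&: D = set0.
    by move=> FD; rewrite setIAC FD set0I.
  by case: (allF v (setU11 _ _)) => /sub; [left|right].
Qed.

End Hit.

Section Blocks.
Variables (R : realType) (T : finType) (E : {set {set T}}).

Lemma chord_cycle (e : rel T) (P : seq T) (v x0 : T) (x y : nat) :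
  symmetric e -> uniq P -> sorted e P -> v \notin P -> (x < y)%N -> (y < size P)%N ->
  e v (nth x0 P x) -> e v (nth x0 P y) ->
  exists2 s, ucycle e s & size s = (y - x).+2.
Proof.
move=> e_sym uP sP vP xy yP ex ey.
pose s := drop x (take y.+1 P).
have st : size (take y.+1 P) = y.+1 by rewrite size_takel.
have ss : size s = (y - x).+1 by rewrite size_drop st subSn // ltnW.
have us : uniq s by rewrite drop_uniq // take_uniq.
have sos : sorted e s by apply/drop_sorted/take_sorted.
have vs : v \notin s by apply: contra vP => /mem_drop/mem_take.
have hs : nth x0 s 0 = nth x0 P x by rewrite nth_drop addn0 nth_take // ltnW.
have ls : last x0 s = nth x0 P y.
  by rewrite -nth_last ss nth_drop subnKC ?nth_take // ltnW.
exists (v :: s); last by rewrite /= ss.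
case: s ss us sos vs hs ls => // h s _ us sos vs hs ls.
rewrite /ucycle cons_uniq vs us andbT /=.
by move: hs ls sos ex ey => /= <- <- ph eh el; rewrite eh rcons_path ph e_sym el.
Qed.

Lemma cut_size_degree (S W : {set T}) (m : nat) :
  (forall s, s \in S -> (m <= #|[set w in W | adj E s w]|)%N) ->
  (#|S| * m <= cut_size E S W)%N.
Proof.
move=> deg; rewrite -sum_nat_const.
apply: leq_trans (_ : \sum_(s in S) #|[set w in W | adj E s w]| <= _)%N.
  by apply: leq_sum.
rewrite /cut_size; under eq_bigr do rewrite -sum1_card.
under [X in (_ <= X)%N]eq_bigr do rewrite -sum1_card.
rewrite (exchange_big_dep (fun w => w \in W)) /=; last first.
  by move=> s w _; rewrite inE => /andP[].
apply/eq_leq/eq_bigr => w wW; apply: eq_bigl => s; rewrite !inE wW.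
by [].
Qed.

Variables (P : seq T) (b r : nat) (c : R).
Hypotheses (P_uniq : uniq P) (P_size : size P = (2 * r * b)%N) (b_gt0 : (0 < b)%N).
Hypothesis c_gt0 : 0 < c.

(** The path P is cut into 2 r blocks of b vertices; only every other block is
used, so that distinct used blocks are at distance more than b. *)
Definition block (i : nat) : seq T := take b (drop (2 * i * b) P).

Definition outside : {set T} := ~: [set z in P].

Definition block_degree (i : nat) (v : T) := #|[set a in [set z in block i] | adj E a v]|.

Definition rich (i : nat) := [set v in outside | c / 2 * b%:R <= (block_degree i v)%:R].

Definition connectors :=
  [set v | [exists i : 'I_r, exists j : 'I_r, (i < j)%N && (v \in rich i) && (v \in rich j)]].

Lemma size_block i : (i < r)%N -> size (block i) = b.
Proof.
move=> ir; rewrite size_takel // size_drop P_size -mulnBl -mulnBr.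
by rewrite leq_pmull // muln_gt0 subn_gt0 ir.
Qed.

Lemma block_sub i : {subset block i <= P}.
Proof. by move=> z /mem_take/mem_drop. Qed.

Lemma card_block i : (i < r)%N -> #|[set z in block i]| = b.
Proof.
move=> ir; rewrite cardsE (card_uniqP _) ?size_block //.
by rewrite take_uniq // drop_uniq.
Qed.

Lemma block_nth x0 i z : (i < r)%N -> z \in block i ->
  exists x, [/\ (2 * i * b <= x)%N, (x < 2 * i * b + b)%N & z = nth x0 P x].
Proof.
move=> ir /(nthP x0)[y]; rewrite size_block // => yb <-.
exists (2 * i * b + y)%N; rewrite leq_addr ltn_add2l yb; split=> //.
by rewrite nth_take // nth_drop.
Qed.

(** The vertices of a block send at least 3 d / 4 edges each out of P, and a vertex
that is not rich receives at most c b / 2 of them. *)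
Lemma rich_card i (d : nat) : (i < r)%N -> d%:R = c * #|T|%:R ->
  (forall v, (d <= #|ext_nbhd E [set v]|)%N) -> 4 * (size P)%:R <= d%:R :> R ->
  c / 4 * #|T|%:R <= #|rich i|%:R.
Proof.
move=> ir dn deg Pd; set n : R := #|T|%:R.
have bR : 0 < b%:R :> R by rewrite ltr0n.
have lo : (b * (d - size P) <= cut_size E [set z in block i] outside)%N.
  rewrite -{1}(card_block ir); apply: cut_size_degree => a; rewrite inE => aP.
  rewrite leq_subLR; apply: leq_trans (deg a) _.
  apply: leq_trans (_ : #|[set z in P]| + #|[set w in outside | adj E a w]| <= _)%N; last first.
    by rewrite cardsE (card_uniqP P_uniq).
  apply: leq_trans (leq_card_setU _ _).1; apply/subset_leq_card/subsetP => w.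
  rewrite !inE => /andP[_ /existsP[u]]; rewrite inE => /andP[/eqP -> ->].
  by rewrite andbT orbN.
have hi : (cut_size E [set z in block i] outside)%:R <=
    b%:R * #|rich i|%:R + n * (c / 2 * b%:R).
  rewrite natr_sum (bigID (fun w => w \in rich i)) /=; apply: lerD.
    apply: le_trans (_ : \sum_(w in outside | w \in rich i) b%:R <= _).
      by apply: ler_sum => w _; rewrite ler_nat -(card_block ir) subset_leq_card // setIdE subsetIl.
    rewrite sumr_const -[leLHS]mulr_natr ler_wpM2l ?ler_nat ?subset_leq_card //.
    by apply/subsetP => w /andP[].
  apply: le_trans (_ : \sum_(w in outside | w \notin rich i) c / 2 * b%:R <= _).
    apply: ler_sum => w /andP[wO]; rewrite inE wO /= -ltNge; exact: ltW.
  rewrite sumr_const -[leLHS]mulr_natl ler_wpM2r ?ler_nat ?max_card //.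
  by rewrite mulr_ge0 // divr_ge0 // ltW.
have := lo; rewrite -(ler_nat R) natrM natrB; last first.
  by rewrite -(ler_nat R); have := ler0n R (size P); lra.
move=> lo'; have := le_trans lo' hi.
rewrite (_ : n * (c / 2 * b%:R) = b%:R * (c / 2 * n)); last by ring.
rewrite -mulrDr ler_pM2l // => H.
by move: H; rewrite dn -/n; rewrite dn -/n in Pd; lra.
Qed.

(** With r >= 8 / c blocks, the rich sets have total size at least 2 n, so that a
proportion 1 / r of the vertices is rich for two blocks. *)
Lemma connectors_card (d : nat) : d%:R = c * #|T|%:R -> 8 <= c * r%:R ->
  (forall v, (d <= #|ext_nbhd E [set v]|)%N) -> 4 * (size P)%:R <= d%:R :> R ->
  (#|T| <= r * #|connectors|)%N.
Proof.
move=> dn cr deg Pd.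
have lo : 2 * #|T|%:R <= (\sum_(i < r) #|rich i|)%:R :> R.
  rewrite natr_sum; apply: le_trans (_ : \sum_(i < r) c / 4 * #|T|%:R <= _).
    rewrite sumr_const card_ord -mulr_natl.
    by have := ler_wpM2r (ler0n R #|T|) cr; lra.
  by apply: ler_sum => i _; apply: rich_card deg Pd.
have hi : (\sum_(i < r) #|rich i| <= #|T| + r * #|connectors|)%N.
  under eq_bigr do rewrite -sum1_card.
  rewrite (exchange_big_dep xpredT) //= -sum1_card mulnC -sum_nat_const.
  rewrite [X in (_ <= _ + X)%N]big_mkcond -big_split /=; apply: leq_sum => v _.
  rewrite sum1_card; case: ifP => [_|/negbT].
    by rewrite (leq_trans (max_card _)) // card_ord leq_addl.
  rewrite inE negb_exists addn0 => /forallP nc; rewrite leqNgt; apply/negP.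
  move=> /card_gt1P[i [j [vi vj ij]]].
  wlog lij : i j vi vj ij / (i < j)%N => [wl|].
    have /orP[lij|lij] : (i < j)%N || (j < i)%N by rewrite -neq_ltn.
      exact: (wl i j).
    by apply: (wl j i) => //; rewrite eq_sym.
  have := nc i; rewrite negb_exists => /forallP/(_ j); rewrite lij.
  by rewrite (vi : v \in rich i) (vj : v \in rich j).
by move: lo; rewrite -natrM ler_nat => lo; move: (leq_trans lo hi); rewrite mul2n -addnn leq_add2l.
Qed.

Lemma block_inj i j a : (i < r)%N -> (j < r)%N -> a \in block i -> a \in block j -> i = j.
Proof.
wlog lij : i j / (i < j)%N => [wl|] ir jr ai aj.
  have [lij|lji|//] := ltngtP i j; first exact: (wl i j).
  by apply/esym; apply: (wl j i).
have [x [_ x2 ax]] := block_nth a ir ai.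
have [y [y1 y2 ay]] := block_nth a jr aj.
have xy : (x < y)%N.
  apply: leq_trans x2 (leq_trans _ y1).
  by rewrite -mulSnr leq_mul2r ltn_mul2l lij orbT.
have yP : (y < size P)%N.
  apply: leq_trans y2 _; rewrite P_size -mulSnr leq_mul2r ltn_mul2l jr orbT //.
have /eqP : nth a P x = nth a P y by rewrite -ax.
by rewrite nth_uniq // ?(ltn_trans xy) // ltn_eqF.
Qed.

Lemma block_link (F : {set {set T}}) i j a a' v :
  sorted (adj F) P -> v \in outside -> (i < j)%N -> (j < r)%N ->
  a \in block i -> a' \in block j -> adj F v a -> adj F v a' -> has_cycle b.+3 F.
Proof.
move=> sP; rewrite !inE => vP ij jr ai aj va va'.
have ir := ltn_trans ij jr.
have [x [_ x2 ax]] := block_nth v ir ai.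
have [y [y1 y2 ay]] := block_nth v jr aj.
have xy : (x + b < y)%N.
  apply: leq_trans y1; rewrite -addSn.
  apply: leq_trans (leq_add x2 (leqnn b)) _.
  rewrite -addnA addnn -mul2n -mulnDl.
  by rewrite [(2 * i + 2)%N]addnC -mulnS leq_mul2r leq_mul2l ij !orbT.
have yP : (y < size P)%N.
  by apply: leq_trans y2 _; rewrite P_size -mulSnr leq_mul2r ltn_mul2l jr orbT.
have [|||s cs ss] := @chord_cycle (adj F) P v v x y (adjC F) P_uniq sP vP _ yP _ _.
- by apply: leq_ltn_trans xy; apply: leq_addr.
- by rewrite -ax.
- by rewrite -ay.
have les : (b.+3 <= size s)%N by rewrite ss !ltnS ltn_subRL.
by exists s; split=> //; split=> //; apply: leq_trans les.
Qed.

Definition star (i : nat) (v : T) : {set {set T}} :=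
  [set [set a; v] | a in [set a in [set z in block i] | adj E a v]].

Lemma star_sub i v : star i v \subset E.
Proof. by apply/subsetP => f /imsetP[a]; rewrite inE => /andP[_ aE] ->. Qed.

Lemma edge_inj (a a' v w : T) : a != w -> a' != v -> [set a; v] = [set a'; w] -> a = a' /\ v = w.
Proof.
move=> aw a'v eqs.
have : a \in [set a'; w] by rewrite -eqs set21.
have : v \in [set a'; w] by rewrite -eqs set22.
by rewrite !inE (negPf aw) orbF eq_sym (negPf a'v) /= => /eqP -> /eqP ->.
Qed.

Lemma block_neq i a v : a \in block i -> v \in outside -> a != v.
Proof.
by move=> /block_sub aP; rewrite !inE; apply: contraNneq => <-.
Qed.

Lemma card_star i v : v \in outside -> #|star i v| = block_degree i v.
Proof.
move=> vO; apply: card_in_imset => a a'; rewrite !inE => /andP[ai _] /andP[ai' _] eqs.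
by have [] := edge_inj (block_neq ai vO) (block_neq ai' vO) eqs.
Qed.

Lemma star_disjoint i j v w : (i < r)%N -> (j < r)%N -> v \in outside -> w \in outside ->
  (i != j) || (v != w) -> [disjoint star i v & star j w].
Proof.
move=> ir jr vO wO ne; rewrite -setI_eq0; apply/eqP/setP => f; rewrite !inE.
apply/negP => /andP[/imsetP[a + ->] /imsetP[a' + fE]].
rewrite !inE => /andP[ai _] /andP[aj _].
have [aa' vw] := edge_inj (block_neq ai wO) (block_neq aj vO) fE.
by move: ne; rewrite vw eqxx orbF => /eqP; apply; apply: (block_inj ir jr ai); rewrite aa'.
Qed.

(** The stars of a connector to its two blocks consist of at least c b / 2 edges;
mu bounds the probability that none of that many edges is kept. *)
Lemma sprinkle_cycle (F1 : {set {set T}}) (p mu : R) : 0 <= p <= 1 -> 0 <= mu -> mu <= 1 ->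
  sorted (adj F1) P ->
  (forall m : nat, c / 2 * b%:R <= m%:R -> (1 - p) ^+ m <= mu) ->
  Pr E p (fun F2 => ~ has_cycle b.+3 (F1 :|: F2)) <= (1 - (1 - mu) ^+ 2) ^+ #|connectors|.
Proof.
move=> p01 mu0 mu1 sP pmu.
have /choice[f fP] : forall v, exists ij : nat * nat, v \in connectors ->
    [/\ (ij.1 < ij.2)%N, (ij.2 < r)%N, v \in rich ij.1 & v \in rich ij.2].
  move=> v; have [|nv] := boolP (v \in connectors); last by exists (0%N, 0%N).
  rewrite inE => /existsP[i /existsP[j /andP[/andP[ij vi] vj]]].
  by exists (val i, val j) => _; split=> //=; apply: ltn_ord.
have lt1 v : v \in connectors -> ((f v).1 < r)%N.
  by move=> /fP[ij jr _ _]; apply: ltn_trans jr.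
have out v : v \in connectors -> v \in outside by move=> /fP[_ _]; rewrite inE => /andP[].
apply: le_trans (miss_all_le (W := connectors) (D1 := fun v => star (f v).1 v)
  (D2 := fun v => star (f v).2 v) p01 mu0 mu1 _ _).
- apply: le_Pr => // F2 _ noC v vW; have [ij jr vi vj] := fP v vW.
  have adj2 i : F2 :&: star i v != set0 ->
      exists2 a, a \in block i & adj (F1 :|: F2) v a.
    case/set0Pn => g; rewrite inE => /andP[gF /imsetP[a]]; rewrite !inE => /andP[ai _] gE.
    by exists a => //; rewrite /adj inE setUC -gE gF orbT.
  have [->|/adj2[a ai va]] := eqVneq (F2 :&: star (f v).1 v) set0; first by left.
  have [->|/adj2[a' aj va']] := eqVneq (F2 :&: star (f v).2 v) set0; first by right.
  case: noC; apply: (block_link _ (out v vW) ij jr ai aj va va').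
  by apply: sub_sorted sP; apply: adj_sub; apply: subsetUl.
- move=> v vW; have [ij jr vi vj] := fP v vW; have vO := out v vW.
  split; rewrite ?star_sub //.
  + by apply: star_disjoint; rewrite ?lt1 // ltn_eqF.
  + by apply: pmu; rewrite card_star //; move: vi; rewrite inE => /andP[].
  + by apply: pmu; rewrite card_star //; move: vj; rewrite inE => /andP[].
move=> v w vW wW vw; have [ij jr _ _] := fP v vW; have [ij' jr' _ _] := fP w wW.
have disj i j : (i < r)%N -> (j < r)%N -> [disjoint star i v & star j w].
  by move=> ir jr''; apply: star_disjoint; rewrite ?out // vw orbT.
rewrite -setI_eq0 setIUl !setIUr !setU_eq0 !setI_eq0.
by rewrite !disj // lt1.
Qed.

End Blocks.

Section MinDegree.
Variable R : realType.

Lemma dfs_arith (e D p1 s l : R) : 0 < e -> e <= 1 -> 0 < D -> p1 * D = 1 + e / 2 ->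
  0 < s -> s <= e * D / 8 -> 0 <= l -> l <= e * s / 16 ->
  (1 + e / 16) * (s + l) <= p1 * (s * (D - (s + l))).
Proof.
move=> e0 e1 D0 pD s0 sD l0 ls.
have p10 : 0 < p1 by rewrite -(@pmulr_lgt0 _ D) // pD; lra.
have es : e * s <= s by rewrite ger_pMl.
have sl : s + l <= s * (1 + e / 16) by lra.
have slD : s + l <= e * D * (17 / 128) by lra.
have h1 : (1 + e / 16) * (s + l) <= (1 + e / 16) * (s * (1 + e / 16)).
  by apply: ler_wpM2l => //; lra.
apply: le_trans h1 _.
have h2 : D * (1 - e * (17 / 128)) <= D - (s + l) by lra.
have h3 : p1 * (s * (D * (1 - e * (17 / 128)))) <= p1 * (s * (D - (s + l))).
  by rewrite ler_pM2l // ler_pM2l.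
apply: le_trans h3.
have -> : p1 * (s * (D * (1 - e * (17 / 128)))) = s * ((1 + e / 2) * (1 - e * (17 / 128))).
  by rewrite -pD; ring.
rewrite mulrCA ler_pM2l //.
have e2 : e * e <= e by rewrite ger_pMl.
lra.
Qed.

(** As long as the search has visited at most about eps d / 8 vertices, every
abandoned vertex has at least (1 - eps / 7) d unvisited neighbours, all queried in
vain, and this is compensated by the factor 1 + eps / 2 in the density. *)
Lemma min_degree_path (T : finType) (E : {set {set T}}) (d : nat) (e q : R) :
  0 < e -> e <= 1 -> (d <= #|T|)%N -> 0 < q -> q <= 1 -> q * d%:R = 1 + e / 2 ->
  16 <= e * d%:R -> (forall v, (d <= #|ext_nbhd E [set v]|)%N) ->
  exists2 m : nat, e ^+ 2 * d%:R / 256 <= m%:R &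
    Pr E q (fun F => ~ has_path F set0 m) <= expR (- ((e / 16) ^+ 2 / 16 * (e * d%:R / 16))).
Proof.
move=> e0 e1 dn q0 q1 qd eD deg; set D : R := d%:R in qd eD *.
have D0 : 0 < D by rewrite -(pmulr_rgt0 _ e0); lra.
have eDD : e * D <= D by rewrite ger_pMl.
pose s0 := Num.truncn (e * D / 8).
have [s0_le s0_ge] : s0%:R <= e * D / 8 /\ e * D / 16 <= s0%:R.
  have /andP[h1] : s0%:R <= e * D / 8 < s0.+1%:R by apply: truncn_itv; lra.
  by rewrite -[s0.+1%:R]natr1 => h2; split=> //; lra.
have s00 : 0 < s0%:R :> R by lra.
have es0 : 0 < e * s0%:R by rewrite mulr_gt0.
have es_s : e * s0%:R <= s0%:R by rewrite ger_pMl.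
pose l0 := Num.truncn (e * s0%:R / 16).
have /andP[l0_le l0_gt] : l0%:R <= e * s0%:R / 16 < l0.+1%:R by apply: truncn_itv; lra.
have l0R : 0 <= l0%:R :> R by rewrite ler0n.
have sl : s0%:R + l0%:R < D by lra.
have sl_nat : (s0 + l0 < d)%N by rewrite -(ltr_nat R) natrD.
exists l0.+1.
  apply: le_trans (ltW l0_gt).
  have : e * (e * D / 16) <= e * s0%:R by rewrite ler_pM2l.
  by rewrite expr2; lra.
apply: le_trans (_ : expR (- ((e / 16) ^+ 2 / 16 * (s0 + l0)%:R)) <= _); last first.
  rewrite ler_expR lerN2 ler_wpM2l ?divr_ge0 ?sqr_ge0 //.
  by rewrite natrD; lra.
apply: (dfs_exp _ _ _ q0) => //.
- by rewrite q1 ltW.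
- by rewrite divr_gt0.
- by lra.
- by rewrite ger_pMl //; lra.
- by rewrite cards0 addn0; apply: leq_trans dn.
move=> S U cS cU _.
have lo : (#|S| * (d - (s0 + l0)) <= cut_size E S (~: (S :|: U :|: set0)))%N.
  apply: cut_size_degree => s sS; rewrite leq_subLR.
  have ss : [set s] \subset S by rewrite sub1set.
  have := card_nbhd_in E U set0 ss; move/(leq_trans (deg s)).
  rewrite cards0 addn0 cS addnC => /leq_trans; apply; apply: leq_add; first by rewrite leq_add2l.
  apply/subset_leq_card/subsetP => z; rewrite !inE => /andP[-> /existsP[s']].
  by rewrite inE => /andP[/eqP ->].
have := lo; rewrite -(ler_nat R) natrM natrB; last exact: ltnW.
rewrite natrD -/D cS => lo'.
apply: le_trans (ler_wpM2l (ltW q0) lo'). 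
exact: dfs_arith.
Qed.

(** Cutting the path into about 18 / c blocks, a positive proportion of the
vertices has many neighbours in two of the used blocks, and each of these
vertices closes a long cycle with a probability that does not depend on n. *)
Lemma min_degree_link (T : finType) (E F1 : {set {set T}}) (d b : nat) (c q mu : R) (u : seq T) :
  0 < c -> c < 1 -> d%:R = c * #|T|%:R -> (forall v, (d <= #|ext_nbhd E [set v]|)%N) ->
  0 <= q <= 1 -> 0 <= mu -> mu <= 1 -> (0 < b)%N ->
  uniq u -> sorted (adj F1) u -> 18 / c * b%:R <= (size u)%:R -> 72 / c * b%:R <= d%:R ->
  (forall m : nat, c / 2 * b%:R <= m%:R -> (1 - q) ^+ m <= mu) ->
  Pr E q (fun F2 => ~ has_cycle b.+3 (F1 :|: F2)) <=
    expR (- ((1 - mu) ^+ 2 * (c / 9) * #|T|%:R)).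
Proof.
move=> c0 c1 dn deg q01 mu0 mu1 b0 uu su lu bd qmu; set n : R := #|T|%:R in dn *.
pose r := Num.truncn (9 / c).
have c9 : 0 <= 9 / c by rewrite divr_ge0 // ltW.
have [r_le cr] : r%:R <= 9 / c /\ 8 <= c * r%:R.
  have /andP[h1] : r%:R <= 9 / c < r.+1%:R by apply: truncn_itv.
  by rewrite -[r.+1%:R]natr1 ltr_pdivrMr // => h2; split=> //; lra.
have rc : c * r%:R <= 9 by rewrite mulrC -ler_pdivlMr.
have rb : (2 * r * b)%:R <= 18 / c * b%:R :> R.
  by rewrite !natrM ler_wpM2r //; lra.
have rb_u : (2 * r * b <= size u)%N by rewrite -(ler_nat R); apply: le_trans lu.
have sP : size (take (2 * r * b) u) = (2 * r * b)%N by rewrite size_takel.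
have uP : uniq (take (2 * r * b) u) by rewrite take_uniq.
apply: (le_trans (sprinkle_cycle E uP sP q01 mu0 mu1 (take_sorted _ su) qmu)).
have Pd : 4 * (size (take (2 * r * b) u))%:R <= d%:R :> R by rewrite sP; lra.
have cW := connectors_card uP sP b0 c0 dn cr deg Pd.
move: (#|connectors _ _ _ _ _|) cW => W cW.
have nW : c / 9 * n <= W%:R.
  have : n <= r%:R * W%:R by rewrite -natrM ler_nat.
  move=> /(ler_wpM2l (ltW c0)); rewrite mulrA => h.
  have := le_trans h (ler_wpM2r (ler0n R W) rc); lra.
apply: le_trans (_ : expR (- (1 - mu) ^+ 2) ^+ W <= _).
  apply: lerXn2r; rewrite ?nnegrE ?expR_ge0 //; last exact: expR_ge1Dx.
  by rewrite expr2; nra.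
rewrite -expRM_natl ler_expR mulrN lerN2 -[leLHS]mulrA [leRHS]mulrC.
by rewrite ler_wpM2l ?sqr_ge0.
Qed.

Lemma long_cycle_min_degree (c e : R) : 0 < c -> c < 1 -> 0 < e -> e <= 1 ->
  exists2 g : R, 0 < g & forall (T : finType) (E : {set {set T}}) (d : nat) (p : R),
    (0 < d)%N -> p = (1 + e) / d%:R -> p <= 1 -> d%:R = c * #|T|%:R ->
    (forall v, (d <= #|ext_nbhd E [set v]|)%N) ->
    48 * 96 <= e ^+ 2 * c ^+ 2 * #|T|%:R ->
    exists t : nat, [/\ (3 <= t)%N, e ^+ 2 * c ^+ 2 * #|T|%:R / (96 * 96) <= t%:R &
      (1 - expR (- (g * #|T|%:R))) ^+ 2 <= Pr E p (has_cycle t)].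
Proof.
move=> c0 c1 e0 e1.
pose w := e ^+ 3 * c ^+ 2 / (384 * 96).
have w0 : 0 < w by rewrite divr_gt0 ?mulr_gt0 ?exprn_gt0.
pose mu := expR (- w).
have mu0 : 0 <= mu by apply: expR_ge0.
have mu1 : mu < 1 by rewrite expR_lt1 oppr_lt0.
pose g1 := (e / 16) ^+ 2 / 16 * (e * c / 16).
pose g2 := (1 - mu) ^+ 2 * (c / 9).
have g10 : 0 < g1.
  by apply: mulr_gt0; apply: divr_gt0; rewrite ?exprn_gt0 ?divr_gt0 ?mulr_gt0.
have g20 : 0 < g2 by rewrite mulr_gt0 ?exprn_gt0 ?divr_gt0 // subr_gt0.
exists (Num.min g1 g2); first by rewrite lt_min g10.
move=> T E d p d0 pE p1 dn deg nbig.
set n : R := #|T|%:R in nbig dn *.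
set D : R := d%:R in pE dn.
have D0 : 0 < D by rewrite ltr0n.
have n0 : 0 < n by rewrite -(pmulr_rgt0 _ c0) -dn.
have e2D : e ^+ 2 * c * D = e ^+ 2 * c ^+ 2 * n by rewrite dn; ring.
have eD : 16 <= e * D.
  have : e ^+ 2 * c * D <= e * D.
    by rewrite ler_pM2r // expr2 -mulrA ger_pMr // mulr_ile1 // ltW.
  by rewrite e2D; lra.
(* the second round has density q2, at least e / (2 d) *)
pose q1 := (1 + e / 2) / D; pose q2 := (p - q1) / (1 - q1).
have q1D : q1 * D = 1 + e / 2 by rewrite divfK // gt_eqF.
have pq1 : p - q1 = e / (2 * D).
  by rewrite /q1 pE; field; rewrite gt_eqF.
have pq1_gt0 : 0 < p - q1 by rewrite pq1 divr_gt0 // mulr_gt0.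
have q1_gt0 : 0 < q1 by rewrite divr_gt0 //; lra.
have q1_lt1 : 0 < 1 - q1 by rewrite subr_gt0; apply: lt_le_trans p1; rewrite -subr_gt0.
have q1_01 : 0 <= q1 <= 1 by rewrite ltW //= ltW // -subr_gt0.
have q2_ge : e / (2 * D) <= q2.
  by rewrite -pq1 ler_pdivlMr // ger_pMr // gerBl ltW.
have q2_01 : 0 <= q2 <= 1.
  by rewrite divr_ge0 ?(ltW q1_lt1) ?(ltW pq1_gt0) //= ler_pdivrMr // mul1r lerD2r.
have rounds : 1 - p = (1 - q1) * (1 - q2).
  by rewrite mulrBr mulr1 mulrC divfK ?gt_eqF //; ring.
have dn_nat : (d <= #|T|)%N by rewrite -(ler_nat R) -/D dn ger_pMl // ltW.
have [m m_ge round1] := min_degree_path e0 e1 dn_nat q1_gt0 (proj2 (andP q1_01)) q1D eD deg.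
pose y := e ^+ 2 * c ^+ 2 * n / (48 * 96); pose b := Num.truncn y.
have y1 : 1 <= y by rewrite ler_pdivlMr ?mul1r // mulr_gt0.
have [b_le b_ge] : b%:R <= y /\ y / 2 <= b%:R.
  have /andP[h1] : b%:R <= y < b.+1%:R by apply: truncn_itv; apply: le_trans y1.
  move=> h2; split=> //.
  have : 1 <= b%:R :> R by rewrite ler1n -ltnS -(ltr_nat R); apply: le_lt_trans h2.
  by move: h2; rewrite -[b.+1%:R]natr1; lra.
have b0 : (0 < b)%N.
  by rewrite -(ltr0n R); apply: lt_le_trans b_ge; rewrite divr_gt0 // (lt_le_trans _ y1).
have yE : y / 2 = e ^+ 2 * c ^+ 2 * n / (96 * 96) by rewrite /y; field.
have cb : 18 / c * b%:R <= e ^+ 2 * D / 256.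
  apply: le_trans (_ : 18 / c * y <= _); first by rewrite ler_wpM2l // divr_ge0 // ltW.
  by rewrite /y dn le_eqVlt; apply/orP; left; apply/eqP; field; rewrite gt_eqF.
have cbD : 72 / c * b%:R <= D.
  apply: le_trans (_ : 4 * (e ^+ 2 * D / 256) <= _); last first.
    have : e ^+ 2 * D <= D by rewrite ger_pMl // exprn_ile1 // ltW.
    by move: (e ^+ 2 * D) => x; move: D0; lra.
  by rewrite -(ler_pM2l (ltr0n R 4)) in cb; apply: le_trans cb; rewrite !mulrA -natrM.
exists b.+3; split=> //.
  by rewrite -yE; apply: le_trans b_ge _; rewrite ler_nat -addn3 leq_addr.
have round2 F1 : has_path F1 set0 m ->
    1 - expR (- (g2 * n)) <= Pr E q2 (fun F2 => has_cycle b.+3 (F1 :|: F2)).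
  case=> u [uu su _ lu]; rewrite PrC lerD2l lerN2.
  apply: min_degree_link uu su _ cbD _ => //; try exact: ltW.
    by apply: le_trans cb (le_trans m_ge _); rewrite ler_nat.
  move=> j jb; apply: le_trans (_ : expR (- q2) ^+ j <= _).
    apply: lerXn2r; rewrite ?nnegrE ?expR_ge0 //; last exact: expR_ge1Dx.
    by rewrite subr_ge0; case/andP: q2_01.
  rewrite -expRM_natl ler_expR mulrN lerN2.
  apply: le_trans (_ : c / 2 * b%:R * (e / (2 * D)) <= _); last first.
    apply: ler_pM => //; first by rewrite mulr_ge0 // divr_ge0 // ltW.
    by rewrite divr_ge0 ?mulr_ge0 // ltW.
  apply: le_trans (_ : c / 2 * (y / 2) * (e / (2 * D)) <= _); last first.
    apply: ler_wpM2r; first by rewrite divr_ge0 // ltW // mulr_gt0.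
    by apply: ler_wpM2l => //; rewrite divr_ge0 // ltW.
  rewrite yE dn /w le_eqVlt; apply/orP; left; apply/eqP; field.
  by rewrite !gt_eqF.
have gmin g' : Num.min g1 g2 <= g' -> expR (- (g' * n)) <= expR (- (Num.min g1 g2 * n)).
  by move=> h; rewrite ler_expR lerN2 ler_wpM2r // ltW.
set z := expR (- (Num.min g1 g2 * n)).
have z1 : z <= 1.
  by rewrite -expR0 ler_expR oppr_le0 mulr_ge0 ?(ltW n0) // ltW // lt_min g10.
apply: le_trans (_ : Pr E q1 (fun F => has_path F set0 m) * (1 - z) <= _).
  rewrite expr2; apply: ler_wpM2r; first by rewrite subr_ge0.
  rewrite PrC lerD2l lerN2; apply: le_trans round1 _; apply: le_trans (gmin g1 _).
    by rewrite ler_expR lerN2 /g1 -/D dn le_eqVlt; apply/orP; left; apply/eqP; field.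
  by rewrite ge_min lexx.
rewrite {2}/Pr (expect_sprinkle _ _ rounds) mulrC -expectZ; apply: le_expect => // F1 _.
case: asboolP => [/round2|_]; last by rewrite mulr0; apply: expect_ge0 => // F _; rewrite ler0n.
rewrite mulr1; apply: le_trans; rewrite lerD2l lerN2; apply: gmin.
by rewrite ge_min lexx orbT.
Qed.

End MinDegree.

(** * Bounded graphs and conclusion *)

Section Conclusion.
Variable R : realType.

Lemma expanding_has_cycle (T : finType) (E : {set {set T}}) (d k : nat) :
  simple_graph E -> (2 <= d)%N -> (0 < k)%N -> (k <= #|T|)%N ->
  (forall S : {set T}, #|S| = k -> (d * #|S| <= #|ext_nbhd E S|)%N) -> has_cycle 3 E.
Proof.
move=> simpE d2 k0 kT expand; have [//|noC] := EM (has_cycle 3 E).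
have irr : irreflexive (adj E).
  move=> v; apply/negP => vE; have := forallP simpE [set v; v].
  by rewrite (vE : [set v; v] \in E) setUid cards1.
have acyc s : ucycle (adj E) s -> (size s < 3)%N.
  move=> cs; rewrite ltnNge; apply/negP => ls; apply: noC.
  by exists s; split=> //; split.
have [S cS nS] := small_nbhd irr acyc kT.
have := leq_trans (expand S cS) nS.
by rewrite cS leqNgt => /negP[]; rewrite -[X in (X < _)%N]mul1n ltn_mul2r k0.
Qed.

Lemma small_graphs (M : nat) : exists2 gam : R, 0 < gam &
  forall (T : finType) (E : {set {set T}}) (d : nat) (p : R),
    (0 < #|T|)%N -> (#|T| <= M)%N -> (d <= #|T|)%N -> 1 <= p * d%:R -> p <= 1 ->
    has_cycle 3 E -> 1 - expR (- (gam * #|T|%:R)) <= Pr E p (has_cycle 3).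
Proof.
pose Q : R := M.+1%:R^-1 ^+ (2 ^ M).
have Q0 : 0 < Q by rewrite exprn_gt0 // invr_gt0.
have M0 : 0 < M.+1%:R :> R by rewrite ltr0n.
exists (Q / M.+1%:R); first by rewrite divr_gt0.
move=> T E d p n0 nM dn pd p1 cE; set n : R := #|T|%:R.
have nM1 : n <= M.+1%:R by rewrite ler_nat ltnW.
have pM : M.+1%:R^-1 <= p.
  rewrite -[leLHS]mul1r ler_pdivrMr //; apply: (le_trans pd).
  have p0 : 0 <= p.
    rewrite leNgt; apply/negP => pneg.
    have : p * d%:R <= 0 by rewrite mulr_le0_ge0 // ltW.
    by move: pd; lra.
  by apply: ler_wpM2l => //; rewrite ler_nat (leq_trans dn) // ltnW.
have p0 : 0 <= p by apply: le_trans pM; rewrite invr_ge0 ltW.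
apply: le_trans (_ : Q <= _).
  apply: le_trans (_ : Q / M.+1%:R * n <= _).
    by rewrite lerBlDr -lerBlDl; apply: expR_ge1Dx.
  by rewrite -mulrA ger_pMr // mulrC ler_pdivrMr // mul1r.
apply: le_trans (Pr_full _ cE); last by rewrite p0.
apply: le_trans (_ : p ^+ (2 ^ M) <= _).
  by apply: lerXn2r; rewrite ?nnegrE // invr_ge0 ltW.
apply: ler_wiXn2l => //; apply: leq_trans (max_card _) _.
rewrite -cardsT -powersetT card_powerset cardsT.
by rewrite leq_exp2l.
Qed.

End Conclusion.

Theorem theorem3 (R : realType) :
  exists2 beta : R, 0 < beta &
  forall c : R, 0 < c -> c < 1 ->
  exists2 eps0 : R, 0 < eps0 &
  forall eps : R, 0 < eps -> eps <= eps0 ->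
  exists2 gamma : R, 0 < gamma &
  forall (d n k : nat) (p : R) (T : finType) (E : {set {set T}}),
    (0 < d)%N -> (0 < n)%N -> (0 < k)%N ->
    k%:R = c * n%:R / d%:R ->
    p = (1 + eps) / d%:R -> p <= 1 ->
    #|T| = n -> simple_graph E ->
    (forall S : {set T}, #|S| = k -> (d * #|S| <= #|ext_nbhd E S|)%N) ->
    1 - expR (- (gamma * n%:R)) <=
    prob_Gp E p (fun F => exists s : seq T,
      is_graph_cycle F s /\ beta * eps ^+ 2 * c ^+ 2 * n%:R <= (size s)%:R).
Proof.
exists (96 * 96)^-1; first by rewrite invr_gt0 mulr_gt0.
move=> c c0 c1; have [tau [gam2 [tau0 gam20 large_k]]] := long_cycle_large_k c0 c1.
exists (Num.min 1 (tau / 2)); first by rewrite lt_min ltr01 divr_gt0.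
move=> e e0; rewrite le_min => /andP[e1 etau].
have [g g0 min_degree] := long_cycle_min_degree c0 c1 e0 e1.
have [gam1 gam10 gam1P] := two_rounds g0.
(* the sum dominates the three lower bounds on n under which the main cases apply *)
pose bound := 40 / c ^+ 2 + 8 / tau + 48 * 96 / (e ^+ 2 * c ^+ 2).
pose M := Num.truncn bound.
have [gam3 gam30 small] := small_graphs R M.
have c20 : 0 < c ^+ 2 by rewrite exprn_gt0.
have e20 : 0 < e ^+ 2 by rewrite exprn_gt0.
have e2 : e ^+ 2 <= e by rewrite expr2 ger_pMr.
have c21 : c ^+ 2 <= 1 by rewrite exprn_ile1 // ltW.
have b1 : 0 < 40 / c ^+ 2 by rewrite divr_gt0.
have b2 : 0 < 8 / tau by rewrite divr_gt0.
have b3 : 0 < 48 * 96 / (e ^+ 2 * c ^+ 2) by rewrite divr_gt0 ?mulr_gt0.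
pose gam := Num.min gam1 (Num.min gam2 gam3).
exists gam; first by rewrite !lt_min gam10 gam20.
move=> d n k p T E d0 n0 k0 kE pE p1 Tn simpE expand; subst n.
set n : R := #|T|%:R in kE *.
have n_gt0 : 0 < n by rewrite ltr0n.
have dR : 0 < d%:R :> R by rewrite ltr0n.
have kd : k%:R * d%:R = c * n by rewrite kE divfK // gt_eqF.
have cn : c * n < n by rewrite gtr_pMl.
have pd_eq : p * d%:R = 1 + e by rewrite pE divfK // gt_eqF.
have pd : 1 <= p * d%:R by rewrite pd_eq lerDl ltW.
have d2 : (2 <= d)%N.
  rewrite -(ltr_nat R); apply: lt_le_trans (_ : p * d%:R <= _).
    by rewrite pd_eq ltrDl.
  by rewrite ger_pMl.
have p01 : 0 <= p <= 1 by rewrite p1 pE divr_ge0 // addr_ge0 // ltW.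
set L := _^-1 * _ * _ * n.
have LE : L = e ^+ 2 * c ^+ 2 * n / (96 * 96) by rewrite /L; ring.
have gam_le g' : gam <= g' -> 1 - expR (- (gam * n)) <= 1 - expR (- (g' * n)).
  by move=> h; rewrite lerD2l lerN2 ler_expR lerN2 ler_wpM2r // ltW.
suff [t Lt Pt] : exists2 t : nat, L <= t%:R & 1 - expR (- (gam * n)) <= Pr E p (has_cycle t).
  rewrite prob_GpE; apply: le_trans Pt (le_Pr p01 _) => F _ [s [cs ts]].
  by exists s; split=> //; apply: le_trans Lt _; rewrite ler_nat.
have kn : k%:R <= n.
  apply: le_trans (ltW cn); rewrite -kd -[leLHS]mulr1 ler_wpM2l // ler1n //.
have dn : d%:R <= n.
  by apply: le_trans (ltW cn); rewrite -kd -[leLHS]mul1r ler_wpM2r // ler1n.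
have L0 : 0 <= L by rewrite LE divr_ge0 // !mulr_ge0 // ltW.
have Ln : L <= tau / 2 * n.
  rewrite LE; apply: le_trans (_ : e ^+ 2 * c ^+ 2 * n <= _).
    by rewrite ler_pdivrMr ?mulr_gt0 // ler_peMr ?mulr_ge0 ?ltW // ; lra.
  rewrite ler_pM2r //; apply: le_trans etau; apply: le_trans e2.
  by rewrite ger_pMr.
have [leM|ltM] := leqP #|T| M.
  exists 3%N; last first.
    apply: le_trans (gam_le gam3 _) _; first by rewrite !ge_min lexx !orbT.
    apply: (small T E d) => //; first by rewrite -(ler_nat R).
    by apply: expanding_has_cycle expand => //; rewrite -(ler_nat R).
  have nb : n <= bound.
    apply: le_trans (_ : M%:R <= _); first by rewrite ler_nat.
    by have /andP[] := truncn_itv (ltW (addr_gt0 (addr_gt0 b1 b2) b3)).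
  have h1 : e ^+ 2 * c ^+ 2 * (40 / c ^+ 2) <= 40.
    have -> : e ^+ 2 * c ^+ 2 * (40 / c ^+ 2) = e ^+ 2 * 40 by field; rewrite gt_eqF.
    by rewrite ger_pMl // (le_trans e2).
  have h2 : e ^+ 2 * c ^+ 2 * (8 / tau) <= 4.
    apply: le_trans (_ : tau / 2 * (8 / tau) <= _).
      rewrite ler_pM2r //; apply: le_trans etau; apply: le_trans e2.
      by rewrite ger_pMr.
    by rewrite le_eqVlt; apply/orP; left; apply/eqP; field; rewrite gt_eqF.
  have h3 : e ^+ 2 * c ^+ 2 * (48 * 96 / (e ^+ 2 * c ^+ 2)) = 48 * 96.
    by field; rewrite !gt_eqF.
  have := ler_wpM2l (ltW (mulr_gt0 e20 c20)) nb.
  rewrite /bound (mulrDr _ (_ + _)) (mulrDr _ (40 / _)) h3 => h; rewrite LE ler_pdivrMr ?mulr_gt0 //.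
  apply: (le_trans h); apply: le_trans (lerD (lerD h1 h2) (lexx _)) _; lra.
have nb : bound < n.
  have /andP[_] := truncn_itv (ltW (addr_gt0 (addr_gt0 b1 b2) b3)).
  by move=> h; apply: lt_le_trans h _; rewrite ler_nat.
case: k => // -[|k] in k0 kE kd expand kn *.
  have [||| t [t3 Lt Pt]] := min_degree T E d p d0 pE p1.
  - by rewrite -kd mul1r.
  - by move=> v; have := expand [set v] (cards1 v); rewrite cards1 muln1.
  - have : 48 * 96 / (e ^+ 2 * c ^+ 2) <= n by rewrite /bound in nb; lra.
    by rewrite ler_pdivrMr ?mulr_gt0 // [leRHS]mulrC.
  exists t; first by rewrite LE.
  apply: le_trans (gam_le gam1 _) _; first by rewrite !ge_min lexx.
  exact: le_trans (gam1P _ n0) Pt.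
(* rounding L up costs 1, and 3 more make this the order of a cycle *)
exists (Num.truncn L + 4)%N.
  by apply: ltW; apply: lt_le_trans (truncnS_gt _) _; rewrite ler_nat addnS ltnS leq_addr.
apply: le_trans (gam_le gam2 _) _; first by rewrite !ge_min lexx orbT.
rewrite PrC lerD2l lerN2; apply: (large_k T E d k.+2) => //.
- have : 40 / c ^+ 2 <= n by rewrite /bound in nb; lra.
  by rewrite ler_pdivrMr // [leRHS]mulrC.
- exact: leq_trans (leq_addl _ 4).
have : 8 / tau <= n by rewrite /bound in nb; lra.
rewrite ler_pdivrMr // => h.
have /andP[tL _] := truncn_itv L0.
by rewrite natrD -/n; lra.
Qed.
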